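(* Given two regular languages (by finite automata), it is decidable whether they are separable by a language definable in $\mathcal{B}\Sigma_1[<,\mathrm{MOD}]$.
   Context: For $d\ge1$, $\mathcal{B}\Sigma_1[<,\mathrm{MOD}_d]$ is the class of languages defined by finite Boolean combinations of existential first-order sentences over words, where a word $a_1\cdots a_n$ is the structure with domain $\{1,\dots,n\}$, order $<$, letter predicates $P_a$, unary predicates ''position $\equiv k \pmod d$'' and $0$-ary predicates ''word length $\equiv k\pmod d$'' for $k\in[1,d]$. $\mathcal{B}\Sigma_1[<,\mathrm{MOD}]$ is the class of languages definable when these modular predicates are available for every $d\ge1$; equivalently it is $\bigcup_{d\ge1}\mathcal{B}\Sigma_1[<,\mathrm{MOD}_d]$. $K,L$ are separable by a class if some member $R$ has $K\subseteq R$, $L\cap R=\emptyset$. *)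

(* Defs.v *)
From mathcomp Require Import all_boot.
Set Implicit Arguments. Unset Strict Implicit. Unset Printing Implicit Defensive.

Definition word_over (k : nat) (w : seq nat) : bool := all (fun a => a < k) w.

(* A nondeterministic finite automaton, given by concrete finite data:
   initial states, final states, and transitions (p, a, q).  States are
   naturals; only finitely many occur, so this is a finite automaton. *)
Record nfa := NFA {
  n_init  : seq nat;
  n_final : seq nat;
  n_trans : seq (nat * nat * nat)
}.

Definition nfa_step (A : nfa) (S : seq nat) (a : nat) : seq nat :=
  [seq t.2 | t <- n_trans A & (t.1.1 \in S) && (t.1.2 == a)].

Definition nfa_accepts (A : nfa) (w : seq nat) : bool :=
  has (fun q => q \in n_final A) (foldl (nfa_step A) (n_init A) w).

Definition nfa_lang (k : nat) (A : nfa) (w : seq nat) : Prop :=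
  word_over k w /\ nfa_accepts A w.

(* A word a_1...a_n is the structure with domain {1,...,n}; variables  *)
(* are indexed by naturals.                                            *)

Inductive atom :=
| ALt  (i j : nat)
| AEq  (i j : nat)
| ALet (a i : nat)
| AMod (d r i : nat)
| ALen (d r : nat).

Inductive qf :=
| QTrue
| QAtom (t : atom)
| QNot (f : qf)
| QAnd (f g : qf)
| QOr  (f g : qf).

(* Σ1 sentence: ∃x_0 ... ∃x_{n-1}. f, with f quantifier-free. *)
Record sigma1 := Sig1 { s_nvars : nat; s_body : qf }.

Inductive bsigma1 :=
| BSig (s : sigma1)
| BNot (f : bsigma1)
| BAnd (f g : bsigma1)
| BOr  (f g : bsigma1).

Definition atom_wf (d n : nat) (t : atom) : bool :=
  match t with
  | ALt i j | AEq i j => (i < n) && (j < n)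
  | ALet _ i => i < n
  | AMod d' r i => [&& d' == d, 1 <= r <= d & i < n]
  | ALen d' r => (d' == d) && (1 <= r <= d)
  end.

Fixpoint qf_wf (d n : nat) (f : qf) : bool :=
  match f with
  | QTrue => true
  | QAtom t => atom_wf d n t
  | QNot g => qf_wf d n g
  | QAnd g h | QOr g h => qf_wf d n g && qf_wf d n h
  end.

Fixpoint bsig_wf (d : nat) (f : bsigma1) : bool :=
  match f with
  | BSig s => qf_wf d (s_nvars s) (s_body s)
  | BNot g => bsig_wf d g
  | BAnd g h | BOr g h => bsig_wf d g && bsig_wf d h
  end.

(* Semantics.  nu : nat -> nat assigns positions to variables; position
   p (1 <= p <= size w) carries the letter nth 0 w p.-1. *)
Definition atom_sat (w : seq nat) (nu : nat -> nat) (t : atom) : bool :=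
  match t with
  | ALt i j => nu i < nu j
  | AEq i j => nu i == nu j
  | ALet a i => nth 0 w (nu i).-1 == a
  | AMod d r i => nu i %% d == r %% d
  | ALen d r => size w %% d == r %% d
  end.

Fixpoint qf_sat (w : seq nat) (nu : nat -> nat) (f : qf) : bool :=
  match f with
  | QTrue => true
  | QAtom t => atom_sat w nu t
  | QNot g => ~~ qf_sat w nu g
  | QAnd g h => qf_sat w nu g && qf_sat w nu h
  | QOr g h => qf_sat w nu g || qf_sat w nu h
  end.

Definition sig1_sat (w : seq nat) (s : sigma1) : Prop :=
  exists vs : seq nat,
    [/\ size vs = s_nvars s,
        all (fun p => 1 <= p <= size w) vs &
        qf_sat w (nth 0 vs) (s_body s)].

Fixpoint bsig_sat (w : seq nat) (f : bsigma1) : Prop :=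
  match f with
  | BSig s => sig1_sat w s
  | BNot g => ~ bsig_sat w g
  | BAnd g h => bsig_sat w g /\ bsig_sat w h
  | BOr g h => bsig_sat w g \/ bsig_sat w h
  end.

(* K and L (languages over the alphabet of size k) are separable by
   BΣ1[<,MOD] = ⋃_{d>=1} BΣ1[<,MOD_d]: some sentence defines R over
   the alphabet with K ⊆ R and L ∩ R = ∅. *)
Definition BSigma1MOD_separable (k : nat) (K L : seq nat -> Prop) : Prop :=
  exists d (f : bsigma1), 0 < d /\ bsig_wf d f /\
    forall w, word_over k w ->
      (K w -> bsig_sat w f) /\ (L w -> ~ bsig_sat w f).

Inductive prf :=
| PZero
| PSucc
| PProj (i : nat)
| PComp (f : prf) (gs : seq prf)
| PRec (f g : prf)
| PMu (f : prf).

(* Big-step semantics; argument lists are untyped (missing arguments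
   read as 0). *)
Inductive eval : prf -> seq nat -> nat -> Prop :=
| eZero xs : eval PZero xs 0
| eSucc xs : eval PSucc xs (head 0 xs).+1
| eProj i xs : eval (PProj i) xs (nth 0 xs i)
| eComp f gs xs ys y :
    evals gs xs ys -> eval f ys y -> eval (PComp f gs) xs y
| eRec0 f g xs y :
    head 0 xs = 0 -> eval f (behead xs) y -> eval (PRec f g) xs y
| eRecS f g xs n z y :
    head 0 xs = n.+1 -> eval (PRec f g) (n :: behead xs) z ->
    eval g (n :: z :: behead xs) y -> eval (PRec f g) xs y
| eMu f xs n :
    eval f (n :: xs) 0 ->
    (forall m, m < n -> exists v, eval f (m :: xs) v.+1) ->
    eval (PMu f) xs n
with evals : seq prf -> seq nat -> seq nat -> Prop :=
| esNil xs : evals [::] xs [::]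
| esCons g gs xs y ys :
    eval g xs y -> evals gs xs ys -> evals (g :: gs) xs (y :: ys).

(* Encoding of inputs as natural numbers (Cantor pairing). *)
Definition cpair (x y : nat) : nat := ((x + y) * (x + y).+1)./2 + y.

Fixpoint enc_seq (s : seq nat) : nat :=
  if s is x :: s' then (cpair x (enc_seq s')).+1 else 0.

Definition enc_trans (t : nat * nat * nat) : nat := cpair (cpair t.1.1 t.1.2) t.2.

Definition enc_nfa (A : nfa) : nat :=
  cpair (enc_seq (n_init A))
        (cpair (enc_seq (n_final A)) (enc_seq (map enc_trans (n_trans A)))).

Definition enc_instance (k : nat) (A B : nfa) : nat :=
  cpair k (cpair (enc_nfa A) (enc_nfa B)).

(* Main.v *)
Require Import Defs.
From mathcomp Require Import all_boot.
From mathcomp Require Import zify boolp.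
Set Implicit Arguments. Unset Strict Implicit. Unset Printing Implicit Defensive.

(* For fixed d, a sentence of BΣ1[<,MOD_d] only sees the length of a word mod d and the
   bounded-length subwords of the word whose letters are tagged with their position mod d.
   Hence K and L are inseparable iff for all d and n some w in K and w' in L agree on this
   information (type_equiv d n).  Explicit d0 and n0 suffice:

   - Every tagged word lies in an ideal B*, which is refined step by step into products of
     optional letters and stars until every letter occurs and every star B* contains
     a power (b1...bl)^N.  Membership in such an ideal is visible to subwords of bounded
     length, so two words with the same type for n0 share a final product.
   - In a star factor both runs then have loops with content exactly B mod d0.  For a period
     s, let C_s be the largest content mod s common to loops at the two states.  If the lengths
     of the loops with content in C_s differ by multiples of some g > s only, passing from s to
     g removes a state from the strongly connected component, so this stops at a period s
     bounded in terms of the automata, hence dividing d0.  At that point all lengths divisible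
     by s are realized modulo any multiple D of s, and the loops can be pumped to words
     with the same n-subwords with respect to D, for every n.

   A type is realized by a word of bounded length, so separability is decided by a finite
   search, which is primitive recursive. *)

(** * Products of letters and stars *)

Lemma subseq_catE (T : eqType) (x u v : seq T) :
  subseq x (u ++ v) <-> exists y z, [/\ x = y ++ z, subseq y u & subseq z v].
Proof.
split=> [/subseqP[m sm ->]|[y [z [-> yu zv]]]]; last exact: cat_subseq.
exists (mask (take (size u) m) u), (mask (drop (size u) m) v).
rewrite -mask_cat ?cat_take_drop ?mask_subseq ?size_takel //.
by rewrite sm size_cat leq_addr.
Qed.

(** This is Simon's congruence of order [n], the equivalence behind piecewise testable languages. *)
Definition sim (T : eqType) n (u v : seq T) :=
  forall x, size x <= n -> subseq x u = subseq x v.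

Lemma sim_sym (T : eqType) n (u v : seq T) : sim n u v -> sim n v u.
Proof. by move=> h x /h. Qed.

Lemma sim_cat (T : eqType) n (u u' v v' : seq T) :
  sim n u u' -> sim n v v' -> sim n (u ++ v) (u' ++ v').
Proof.
move=> hu hv x sx; apply/idP/idP => /subseq_catE[y [z [ex yu zv]]];
  apply/subseq_catE; exists y, z;
  have [sy sz] : size y <= n /\ size z <= n by move: sx; rewrite ex size_cat; lia.
- by rewrite -hu -?hv.
- by rewrite hu ?hv.
Qed.

Lemma first_occurrence (T : eqType) (x : T) w : x \in w ->
  exists w1 w2, w = w1 ++ x :: w2 /\ x \notin w1.
Proof.
elim: w => //= y w IH; rewrite inE; have [<- _|xy /IH[w1 [w2 [-> h]]]] := eqVneq x y.
  by exists [::], w.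
by exists (y :: w1), w2; rewrite inE negb_or xy.
Qed.

Lemma all_without (T : eqType) (B w : seq T) x :
  all (mem B) w -> x \notin w -> all (mem [seq b <- B | b != x]) w.
Proof.
move=> wB xw; apply/allP => y yw /=; rewrite mem_filter (allP wB y yw : y \in B) andbT.
by apply: contraNneq xw => <-.
Qed.

Section Templates.
Variable (T : eqType) (N : nat).

Inductive template_atom := Letter of T | Star of seq T.
Implicit Types (A : template_atom) (P : seq template_atom) (w : seq T).

(** A letter is optional here, so that products are downward closed: they are the ideals of the
    subword order. [fills_atom] is the tight version, in which the letter occurs and a star block
    contains [N] copies of its alphabet. *)
Definition in_atom A w :=
  match A with Letter c => w = [::] \/ w = [:: c] | Star B => all (mem B) w end.

Definition block_power (B : seq T) := flatten (nseq N B).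

Definition fills_atom A w :=
  match A with
  | Letter c => w = [:: c]
  | Star B => all (mem B) w /\ subseq (block_power B) w
  end.

Fixpoint product (Q : template_atom -> seq T -> Prop) P w : Prop :=
  if P is A :: P' then exists u v, [/\ w = u ++ v, Q A u & product Q P' v]
  else w = [::].

Lemma product_cat Q P1 P2 u v :
  product Q P1 u -> product Q P2 v -> product Q (P1 ++ P2) (u ++ v).
Proof.
elim: P1 u => [|A P1 IH] u /=; first by move->.
move=> [u1 [u2 [-> h1 h2]]] hv; exists u1, (u2 ++ v); split=> //.
  by rewrite catA.
exact: IH.
Qed.

Notation ideal := (product in_atom).

Lemma in_atom_sub A u w : subseq u w -> in_atom A w -> in_atom A u.
Proof.
case: A => [c|B] /= uw.
  case=> e; move: uw; rewrite e; first by rewrite subseq0 => /eqP; left.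
  case: u => [|x u]; first by left.
  by rewrite /=; have [->|] := eqVneq x c => // /eqP->; right.
by move=> h; apply/allP => x /(mem_subseq uw); apply/allP.
Qed.

Lemma ideal_sub P u w : subseq u w -> ideal P w -> ideal P u.
Proof.
elim: P u w => [|A P IH] u w uw /=.
  by move=> e; move: uw; rewrite e subseq0 => /eqP.
move=> [w1 [w2 [e h1 h2]]]; move: uw; rewrite e => /subseq_catE[y [z [-> yw zw]]].
exists y, z; split=> //; first exact: in_atom_sub h1.
exact: IH h2.
Qed.

Lemma ideal_nil P : ideal P [::].
Proof.
by elim: P => //= -[c|B] P IH; exists [::], [::]; split=> //; left.
Qed.

(** If [u] does not already start with the matched [x], prefixing [x] keeps it a subword, and it
    stays outside the ideal by downward closure. *)
Lemma obstruction_cons P x w u : subseq u (x :: w) -> ~ ideal P u ->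
  exists v, [/\ subseq (x :: v) (x :: w), size (x :: v) <= (size u).+1 &
                ~ ideal P (x :: v)].
Proof.
case: u => [|y u] //=; first by move=> _ /(_ (ideal_nil P)).
case: eqP => [<-|_] uw hu; first by exists u; rewrite eqxx; split.
exists (y :: u); rewrite eqxx; split=> // h; apply: hu.
exact: ideal_sub (subseq_cons _ _) h.
Qed.

(** Reading greedily, each atom adds at most one letter to the obstruction: a letter atom its own
    letter or the first letter of the word, a star the first letter outside its alphabet. *)
Lemma obstruction P w : ~ ideal P w ->
  exists u, [/\ subseq u w, size u <= (size P).+1 & ~ ideal P u].
Proof.
elim: P w => [|A P IH] w hw.
  case: w hw => [|x w] hw; first by case: hw.
  by exists [:: x]; split=> //=; rewrite eqxx sub0seq.
have hP v : ideal P v -> ~ ideal (A :: P) v -> False.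
  move=> h; apply; exists [::], v; split=> //.
  by case: (A) => //=; left.
(* When [A] cannot absorb [x], an obstruction to [P] that begins with [x] also obstructs
   [A :: P]. *)
have starting x w2 : ~ ideal P (x :: w2) -> (forall u, in_atom A (x :: u) -> False) ->
    exists u, [/\ subseq u (x :: w2), size u <= (size (A :: P)).+1 & ~ ideal (A :: P) u].
  move=> /IH[u [uw su nu]] hx; have [v [vw sv nv]] := obstruction_cons uw nu.
  exists (x :: v); split=> //; first by move: sv su => /=; lia.
  case=> [[|y a] [b [e ha hb]]].
    by apply: nv; rewrite e.
  by case: e ha => <- _ /hx.
case: A hw hP starting => [c|B] hw hP starting.
  case: w hw => [|x w] hw; first by case: hw; exact: ideal_nil.
  have [xc|xc] := eqVneq x c.
    rewrite xc in hw *; have /IH[u [uw su nu]] : ~ ideal P w.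
      by move=> h; apply: hw; exists [:: c], w; split=> //; right.
    exists (c :: u); split=> //=; first by rewrite eqxx.
    case=> a [b [e [ha|ha] hb]]; rewrite ha /= in e.
      by apply: nu; apply: ideal_sub (subseq_cons u c) _; rewrite e.
    by case: e => e; apply: nu; rewrite e.
  apply: starting => [h|u [//|[xc' _]]]; first exact: hP h hw.
  by rewrite xc' eqxx in xc.
have [allB|] := boolP (all (mem B) w).
  by case: hw; exists w, [::]; split; rewrite ?cats0 //; exact: ideal_nil.
rewrite -has_predC => /split_find hB; case: hB hw => x s1 s2 xB nB hw.
have := starting x s2; case=> [h|u /= /andP[xB' _]|u [uw su nu]].
- apply: hw; exists s1, (x :: s2); split=> //; first by rewrite cat_rcons.
  rewrite /= -[all _ _]negbK -has_predC; exact: nB.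
- by move: xB; rewrite /= xB'.
exists u; split=> //; rewrite cat_rcons.
exact: subseq_trans uw (suffix_subseq _ _).
Qed.

Lemma ideal_sim n P w w' :
  size P < n -> sim n w w' -> ideal P w -> ideal P w'.
Proof.
move=> sP ww' hw; apply: contrapT => /obstruction[u [uw su nu]].
by apply: nu; apply: ideal_sub hw; rewrite ww' //; lia.
Qed.

(** An ideal covering the words over [B] without subword [V]: in the greedy search for [V], the
    letter searched for is missing from each stretch before its first occurrence. *)
Fixpoint avoid (B V : seq T) : seq template_atom :=
  if V is v :: V' then
    [:: Star [seq b <- B | b != v], Letter v & avoid B V'] else [::].

Lemma ideal_avoid B V w :
  all (mem B) w -> ~~ subseq V w -> ideal (avoid B V) w.
Proof.
elim: V w => [|v V IH] w wB; first by rewrite sub0seq.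
move=> nV; have [vw|vw] := boolP (v \in w); last first.
  exists w, [::]; split; rewrite ?cats0 //; last exact: (ideal_nil (Letter v :: avoid B V)).
  by apply: all_without.
have [w1 [w2 [e v1]]] := first_occurrence vw; subst w.
move: wB; rewrite all_cat /= => /and3P[w1B _ w2B].
exists w1, (v :: w2); split=> //; first exact: all_without.
exists [:: v], w2; split=> //; first by right.
apply: IH => //; apply: contraNN nV => h.
by apply: subseq_trans (suffix_subseq w1 _); rewrite /= eqxx.
Qed.

(* The summand [N * b * _] pays for one refinement step, which replaces [Star B]
   by at most [N * size B] smaller stars and as many letters. *)
Fixpoint star_weight b :=
  if b is b'.+1 then (star_weight b' + N * b * (star_weight b').+1).+1 else 1.

Definition atom_weight A :=
  match A with Letter _ => 1 | Star B => star_weight (size B) end.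

Definition weight P := \sum_(A <- P) atom_weight A.

Lemma star_weight_leq b b' : b <= b' -> star_weight b <= star_weight b'.
Proof.
move=> /subnK <-; elim: (b' - b) => // n IH; apply: leq_trans IH _.
by rewrite addSn /=; apply/leqW/leq_addr.
Qed.

Lemma size_leq_weight P : size P <= weight P.
Proof.
rewrite /weight; elim: P => [|A P IH]; first by rewrite big_nil.
rewrite big_cons /= -add1n leq_add //; case: A => //= B.
by case: (size B) => //.
Qed.

Lemma weight_avoid B V : {subset V <= B} ->
  weight (avoid B V) <= size V * (star_weight (size B).-1).+1.
Proof.
rewrite /weight; elim: V => [|v V IH] VB /=; first by rewrite big_nil.
rewrite !big_cons /= mulSn addnA leq_add //; last first.
  by apply: IH => x xV; apply: VB; rewrite inE xV orbT.
rewrite addn1 ltnS; apply: star_weight_leq.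
have vB : v \in B by apply: VB; rewrite mem_head.
rewrite size_filter -ltnS prednK; last by case: (B) vB.
rewrite -(count_predC (pred1 v) B) -[X in X < _]add0n ltn_add2r -has_count.
by apply/hasP; exists v => /=.
Qed.

Lemma block_power_sub B : {subset block_power B <= B}.
Proof.
by move=> x /flattenP[s]; rewrite mem_nseq => /andP[_ /eqP->].
Qed.

Lemma size_block_power B : size (block_power B) = N * size B.
Proof. by rewrite /block_power size_flatten /shape map_nseq sumn_nseq mulnC. Qed.

Lemma refine_template P w : ideal P w ->
  product fills_atom P w \/ exists P', weight P' < weight P /\ ideal P' w.
Proof.
have wcons A P' : weight (A :: P') = atom_weight A + weight P'.
  by rewrite /weight big_cons.
elim: P w => [|A P IH] w /=; first by left.
move=> [u [v [-> hu hv]]]; case: (IH v hv) => [gv|[P' [ltP hP']]]; last first.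
  right; exists (A :: P'); split; last by exists u, v.
  by rewrite !wcons ltn_add2l.
have [fu|] := EM (fills_atom A u); first by left; exists u, v.
case: A hu => [c|B] /= hu nu.
  right; exists P; split; first by rewrite wcons.
  by case: hu => // ->.
right; exists (avoid B (block_power B) ++ P); split.
  rewrite wcons /weight big_cat /= ltn_add2r.
  apply: leq_ltn_trans (weight_avoid (@block_power_sub B)) _.
  rewrite size_block_power; case: (size B) => [|b] /=; first by rewrite muln0 mul0n.
  by rewrite ltnS leq_addl.
apply: product_cat => //; apply: ideal_avoid => //.
by apply/negP => h; apply: nu.
Qed.

(** Refine with respect to whichever word does not fill the product. The other word follows by
    [ideal_sim], as the product has size at most its weight, hence below [n]; the weight decreases,
    so this ends with both words filling the same product. *)
Lemma common_template P n w w' :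
  weight P < n -> sim n w w' -> ideal P w -> ideal P w' ->
  exists P', product fills_atom P' w /\ product fills_atom P' w'.
Proof.
move: {2}(weight P).+1 (ltnSn (weight P)) => m.
elim: m P w w' => // m IH P w w' Pm Pn ww' hw hw'.
have step Q u u' : weight Q < weight P -> sim n u u' -> ideal Q u ->
    exists P', product fills_atom P' u /\ product fills_atom P' u'.
  move=> ltQ uu' hu; apply: (IH Q) => //; try lia.
  by apply: ideal_sim uu' hu; have := size_leq_weight Q; lia.
case: (refine_template hw) => [gw|[Q [ltQ hQ]]]; last exact: step hQ.
case: (refine_template hw') => [gw'|[Q [ltQ hQ]]]; first by exists P.
by have [P' []] := step _ _ _ ltQ (sim_sym ww') hQ; exists P'.
Qed.

End Templates.

(** * Loops and their lengths *)

(** The start position [t] is a parameter so that factors keep the tags they carry inside a longer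
    word. *)
Fixpoint phased d t (w : seq nat) : seq (nat * nat) :=
  if w is a :: w' then (a, t %% d) :: phased d t.+1 w' else [::].

Lemma phased_cat d t u v :
  phased d t (u ++ v) = phased d t u ++ phased d (t + size u) v.
Proof.
by elim: u t => [|a u IH] t /=; rewrite ?addn0 // IH addSnnS.
Qed.

Lemma size_phased d t u : size (phased d t u) = size u.
Proof. by elim: u t => //= a u IH t; rewrite IH. Qed.

Lemma eq_phased d t t' w : t = t' %[mod d] -> phased d t w = phased d t' w.
Proof.
elim: w t t' => //= a w IH t t' e; rewrite e (IH _ t'.+1) //.
by rewrite -addn1 -(addn1 t') -modnDml e modnDml.
Qed.

Definition reduce_phase s (c : nat * nat) := (c.1, c.2 %% s).

Lemma map_phased s d t w : s %| d ->
  map (reduce_phase s) (phased d t w) = phased s t w.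
Proof.
by move=> sd; elim: w t => //= a w IH t; rewrite IH /reduce_phase /= modn_dvdm.
Qed.

Lemma mem_phased d t w c : c \in phased d t w <->
  exists u a v, w = u ++ a :: v /\ c = (a, (t + size u) %% d).
Proof.
split.
  elim: w t => //= b w IH t; rewrite inE => /orP[/eqP->|/IH[u [a [v [-> ->]]]]].
    by exists [::], b, w; rewrite addn0.
  by exists (b :: u), a, v; rewrite /= addSnnS.
by move=> [u [a [v [-> ->]]]]; rewrite phased_cat mem_cat mem_head orbT.
Qed.

Definition phased_letters k d := allpairs pair (iota 0 k) (iota 0 d).

Lemma phased_lettersP k d t w : 0 < d -> word_over k w ->
  {subset phased d t w <= phased_letters k d}.
Proof.
move=> d_gt0 /allP wk c /mem_phased[u [a [v [wE ->]]]].
apply: allpairs_f; rewrite mem_iota /= ?ltn_pmod //.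
by apply: wk; rewrite wE mem_cat mem_head orbT.
Qed.

Definition transitions := nat -> nat -> nat -> Prop.

Fixpoint run (tr : transitions) p w q : Prop :=
  if w is a :: w' then exists p1, tr p a p1 /\ run tr p1 w' q else p = q.

Lemma run_cat tr p u v q :
  run tr p (u ++ v) q <-> exists r, run tr p u r /\ run tr r v q.
Proof.
elim: u p => [|a u IH] p /=; first by split=> [h|[r [-> h]]]; [exists p|].
split=> [[p1 [h1 /IH[r [h2 h3]]]]|[r [[p1 [h1 h2]] h3]]].
  by exists r; split=> //; exists p1.
by exists p1; split=> //; apply/IH; exists r.
Qed.

Lemma run_word_over tr k p w q :
  (forall p a q, tr p a q -> a < k) -> run tr p w q -> word_over k w.
Proof. by move=> trk; elim: w p => //= a w IH p [p1 [/trk -> /IH]]. Qed.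

Lemma run_trace tr p w q : run tr p w q -> exists rho : nat -> nat,
  [/\ rho 0 = p, rho (size w) = q &
      forall i j, i <= j <= size w -> run tr (rho i) (take (j - i) (drop i w)) (rho j)].
Proof.
elim: w p => [|a w IH] p /=.
  by move=> ->; exists (fun=> q); split.
move=> [p1 [ha /IH[rho [h0 hq hrun]]]].
exists (fun i => if i is i'.+1 then rho i' else p); split=> // -[|i] [|j] //=.
  move=> /(hrun 0 j); rewrite drop0 subn0 h0 => h.
  by exists p1.
by rewrite subSS => /(hrun i j).
Qed.

Lemma ltn_count (T : eqType) (a b : pred T) s x :
  subpred a b -> x \in s -> b x -> ~~ a x -> count a s < count b s.
Proof.
move=> ab; elim: s => //= y s IH; rewrite inE => /orP[/eqP<- bx ax|xs bx ax].
  by rewrite bx (negbTE ax) add0n add1n ltnS sub_count.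
rewrite -addnS leq_add ?IH //; by case: (a y) (ab y) => // ->.
Qed.

Lemma subseq_block_power (T : eqType) (L v : seq T) n :
  all (mem L) v -> size v <= n -> subseq v (block_power n L).
Proof.
elim: v n => [|x v IH] n /=; first by rewrite sub0seq.
case: n => // n /andP[xL vL] vn; rewrite /block_power /= -cat1s.
by apply: cat_subseq; [rewrite sub1seq|exact: IH].
Qed.

Lemma lift_mod s D a b : s %| D -> 0 < D -> a = b %[mod s] ->
  exists j, a + j * s = b %[mod D].
Proof.
(* Modulo [D], the term [D.-1 * a] stands for the negative of [a], so this number is the difference
   to be covered by multiples of [s]. *)
move=> sD D0 ab; have sE : s %| b + D.-1 * a.
  have -> : (s %| b + D.-1 * a) = (s %| a + D.-1 * a).
    by rewrite /dvdn -modnDml -ab modnDml.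
  by rewrite -mulSn prednK // dvdn_mulr.
exists ((b + D.-1 * a) %/ s); rewrite divnK //.
by rewrite addnCA -mulSn prednK // addnC mulnC modnMDl.
Qed.

(** * Lengths of loops at one state with restricted content *)

Section LoopGcd.
(** [p] is the base state of the loops and [r] its phase. [C] is kept abstract because the section
    is applied to each of two automata with the same [C], namely [common_content]. *)
Variables (tr : transitions) (Q : seq nat) (p r : nat) (C : nat -> nat * nat -> Prop).
Hypothesis tr_states : forall p a q, tr p a q -> q \in Q.
Hypothesis C_reduce : forall s d c, s %| d -> C d c -> C s (reduce_phase s c).

Definition allowed s t u := forall c, c \in phased s t u -> C s c.

Lemma allowed_cat s t u v :
  allowed s t (u ++ v) <-> allowed s t u /\ allowed s (t + size u) v.
Proof.
rewrite /allowed phased_cat; split=> [h|[h1 h2] c].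
  by split=> c hc; apply: h; rewrite mem_cat hc ?orbT.
by rewrite mem_cat => /orP[/h1|/h2].
Qed.

Lemma eq_allowed s t t' u : t = t' %[mod s] -> allowed s t u -> allowed s t' u.
Proof. by move=> e; rewrite /allowed (eq_phased _ e). Qed.

Lemma allowed_dvd s d t u : s %| d -> allowed d t u -> allowed s t u.
Proof.
move=> sd h c; rewrite -(map_phased _ _ sd) => /mapP[c' hc ->].
exact: C_reduce (h _ hc).
Qed.

Definition loop s x := [/\ run tr p x p, s %| size x & allowed s r x].
Definition loop_length s l := exists2 x, loop s x & size x = l.

Lemma loop_cat s x y : loop s x -> loop s y -> loop s (x ++ y).
Proof.
move=> [x1 x2 x3] [y1 y2 y3]; split; first by apply/run_cat; exists p.
  by rewrite size_cat dvdn_add.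
apply/allowed_cat; split=> //; apply: eq_allowed y3.
by apply/esym/eqP; rewrite -[X in _ == X %[mod _]]addn0 eqn_modDl mod0n.
Qed.

Lemma loop_lengthD s l l' :
  loop_length s l -> loop_length s l' -> loop_length s (l + l').
Proof.
move=> [x hx <-] [y hy <-]; exists (x ++ y); last by rewrite size_cat.
exact: loop_cat.
Qed.

Lemma loop_length0 s : loop_length s 0.
Proof. by exists [::]; split. Qed.

Lemma loop_lengthM s l n : loop_length s l -> loop_length s (n * l).
Proof.
move=> h; elim: n => [|n IH]; first exact: loop_length0.
by rewrite mulSn; apply: loop_lengthD.
Qed.

Lemma loop_length_dvd s l : loop_length s l -> s %| l.
Proof. by move=> [x [_ sx _] <-]. Qed.

(** In the product of the automaton with the integers modulo [s], restricted to letters in [C s],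
    these are the states that share a strongly connected component with [p] at phase [r]. Their
    number is the measure that decreases when the period grows. *)
Definition recurrent s q := exists u v,
  [/\ run tr p u q, run tr q v p, s %| size u /\ s %| size v,
      allowed s r u & allowed s r v].

Definition recurrent_count s := count (fun q => `[< recurrent s q >]) Q.

Lemma recurrent_dvd s d q : s %| d -> recurrent d q -> recurrent s q.
Proof.
move=> sd [u [v [h1 h2 [h3 h4] h5 h6]]]; exists u, v; split=> //.
- by split; apply: dvdn_trans sd _.
- exact: allowed_dvd h5.
- exact: allowed_dvd h6.
Qed.

Lemma recurrent_count_dvd s d : s %| d -> recurrent_count d <= recurrent_count s.
Proof.
move=> sd; apply: sub_count => q /asboolP h; apply/asboolP; exact: recurrent_dvd h.
Qed.

(** Take for [g] the least positive difference of two loop lengths. Loop lengths are closed under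
    addition, so the remainder of [l'] modulo [g] is again such a difference, between
    [l' %/ g * (l + g)] and [l' %/ g * l + l'], and minimality makes it zero. *)
Lemma min_loop_difference s l0 : 0 < s -> 0 < l0 -> loop_length s l0 ->
  exists g l, [/\ 0 < g, loop_length s l, loop_length s (l + g),
     s %| g & forall l', loop_length s l' -> g %| l'].
Proof.
move=> s0 l00 hl0.
pose D g := `[< 0 < g /\ exists l, loop_length s l /\ loop_length s (l + g) >].
have exD : exists g, D g.
  by exists l0; apply/asboolP; split=> //; exists 0; split=> //; exact: loop_length0.
case: (ex_minnP exD) => g /asboolP[g0 [l [hl hlg]]] gmin.
exists g, l; split=> //.
  by rewrite -(dvdn_addr _ (loop_length_dvd hl)); apply: loop_length_dvd.
move=> l' hl'; rewrite /dvdn; apply: contraT => rho0.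
have /gmin : D (l' %% g).
  apply/asboolP; split; first by rewrite lt0n.
  exists (l' %/ g * (l + g)); split; first exact: loop_lengthM.
  rewrite mulnDr -addnA -divn_eq addnC; apply: loop_lengthD => //.
  exact: loop_lengthM.
by rewrite leqNgt ltn_pmod.
Qed.

Lemma run_mem q u q' : run tr q u q' -> 0 < size u -> q' \in Q.
Proof.
elim: u q => //= a [|b u] IH q [p1 [ha hr]] _; first by rewrite -hr; exact: tr_states ha.
exact: IH hr _.
Qed.

(** Let [g = c * s] be the least difference of loop lengths. If [c] is at least 2, the states met at
    the positions [i * s] with [i < c] are distinct, which bounds [c], and the state at position [s]
    is recurrent modulo [s] but not modulo [g]. *)
Lemma loop_dichotomy s l0 : 0 < s -> 0 < l0 -> loop_length s l0 ->
  (exists l, loop_length s l /\ loop_length s (l + s)) \/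
  exists c, 2 <= c <= size Q /\ recurrent_count (c * s) < recurrent_count s.
Proof.
move=> s0 l00 hl0.
have [g [l [g0 hl hlg sg gdiv]]] := min_loop_difference s0 l00 hl0.
have /dvdnP[c gE] := sg; have [c1|c1] := leqP c 1.
  have gs : g = s by move: g0; rewrite gE; case: (c) c1 => [|[|]] // _ _; rewrite mul1n.
  by left; exists l; split=> //; rewrite -[X in l + X]gs.
right; exists c.
have [x [xrun sx xall] sizex] := hl0; rewrite -sizex in l00 hl0.
have gx : g <= size x by apply: dvdn_leq (gdiv _ hl0).
have [rho [rho0 rhox rhorun]] := run_trace xrun.
have slice i j : i <= j <= size x -> s %| i -> s %| j ->
    [/\ run tr (rho i) (take (j - i) (drop i x)) (rho j),
        size (take (j - i) (drop i x)) = j - i &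
        allowed s r (take (j - i) (drop i x))].
  move=> /andP[ij jx] si sj; split; first by apply: rhorun; rewrite ij.
    by rewrite size_takel // size_drop leq_sub2r.
  move: xall; rewrite -{1}(cat_take_drop i x) allowed_cat => -[_].
  rewrite -{1}(cat_take_drop (j - i) (drop i x)) allowed_cat => -[h _].
  apply: eq_allowed h; rewrite size_takel ?(leq_trans ij) //.
  by apply/eqP; rewrite -[X in _ == X %[mod _]]addn0 eqn_modDl mod0n.
have ltc i : i < c -> i * s < g by rewrite gE ltn_pmul2r.
have lex i : i < c -> i * s <= size x by move=> /ltc/ltnW h; apply: leq_trans gx.
(* Equal states would allow cutting out a factor of length [(j - i) * s], which is positive and less
   than [g], although [g] divides every loop length. *)
have rho_inj i j : i < j < c -> rho (i * s) <> rho (j * s).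
  move=> /andP[ij jc] e; have ic : i < c by apply: ltn_trans jc.
  have [h1 h2 h3] := slice 0 (i * s) (lex i ic) (dvdn0 _) (dvdn_mull _ (dvdnn _)).
  have := slice (j * s) (size x); rewrite lex // leqnn.
  move=> /(_ isT (dvdn_mull _ (dvdnn _)) sx) [h4 h5 h6].
  rewrite -e rhox in h4; rewrite rho0 in h1.
  have /gdiv : loop_length s (i * s + (size x - j * s)).
    rewrite -{1}(subn0 (i * s)) -h2 -h5 -size_cat; eexists; last by [].
    split; first by apply/run_cat; eexists; split; [exact: h1|exact: h4].
      by rewrite size_cat h2 h5 dvdn_add ?dvdn_sub ?dvdn_mull.
    apply/allowed_cat; split=> //; apply: eq_allowed h6; rewrite h2.
    by apply/esym/eqP; rewrite -[X in _ == X %[mod _]]addn0 eqn_modDl subn0 modnMl mod0n.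
  move=> /(dvdn_addr ((j - i) * s)).
  have -> : i * s + (size x - j * s) + (j - i) * s = size x.
    by have := lex _ jc; rewrite mulnBl; have : i * s <= j * s; [rewrite leq_mul2r (ltnW ij) orbT|lia].
  rewrite gdiv // => /esym/dvdn_leq; rewrite muln_gt0 subn_gt0 ij s0 => /(_ isT).
  by rewrite leqNgt ltc //; lia.
have rho_Q i : 0 < i <= size x -> rho i \in Q.
  case: i => // i ix; apply: (run_mem (rhorun 0 i.+1 ix)).
  by rewrite size_takel subn0 // size_drop subn0; case/andP: ix.
have ssx : s <= size x by move: (lex 1 c1); rewrite mul1n.
have [hp1 hp2 hp3] := slice 0 s ssx (dvdn0 _) (dvdnn _).
have := slice s (size x); rewrite ssx leqnn => /(_ isT (dvdnn _) sx) [hq1 hq2 hq3].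
rewrite rho0 in hp1; rewrite rhox in hq1; rewrite subn0 in hp1 hp2 hp3.
split.
  rewrite c1 -{1}(size_iota 0 c) -(size_map (fun i => rho (i * s))).
  apply: uniq_leq_size.
    rewrite map_inj_in_uniq ?iota_uniq // => i j; rewrite !mem_iota !add0n => ic jc e.
    by case: (ltngtP i j) => // ij; [case: (rho_inj i j)|case: (rho_inj j i)]; rewrite ?ij.
  move=> y /mapP[i]; rewrite mem_iota add0n => ic ->; case: i ic => [|i] ic.
    (* The start state belongs to [Q] because it is also the last state of the nonempty loop. *)
    by rewrite mul0n rho0 -rhox rho_Q // l00 leqnn.
  by apply: rho_Q; rewrite lex // muln_gt0 s0.
have rec1 : recurrent s (rho s).
  exists (take s (drop 0 x)), (take (size x - s) (drop s x)).
  rewrite hp2 hq2 dvdnn dvdn_sub //; split=> //.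
(* A path [u] from [p] of length divisible by [g], followed by the rest of the loop from position
   [s], would be a loop; then [g] would divide [s]. *)
have nrec : ~ recurrent (c * s) (rho s).
  move=> [u [v [h1 _ [h2 _] h3 _]]].
  have su : s %| size u by apply: dvdn_trans h2; apply: dvdn_mull.
  have /gdiv : loop_length s (size u + (size x - s)).
    rewrite -hq2 -size_cat; eexists; last by [].
    split; first by apply/run_cat; eexists; split; [exact: h1|exact: hq1].
      by rewrite size_cat hq2 dvdn_add ?dvdn_sub.
    apply/allowed_cat; split; first by apply: allowed_dvd h3; apply: dvdn_mull.
    apply: eq_allowed hq3.
    by apply/esym/eqP; rewrite -[X in _ == X %[mod _]]addn0 eqn_modDl mod0n.
  move=> /(dvdn_addr s); rewrite -addnA subnK // (dvdn_addl _ (gdiv _ hl0)).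
  rewrite gE h2 => /esym/dvdn_leq; rewrite s0 => /(_ isT).
  by rewrite -[X in _ <= X]mul1n leq_pmul2r // leqNgt c1.
apply: (ltn_count (x := rho s)) => [q /asboolP h|||].
- by apply/asboolP; apply: recurrent_dvd h; apply: dvdn_mull.
- by rewrite rho_Q // s0.
- exact/asboolP.
- by apply/negP => /asboolP.
Qed.

(** * Pumping loops so as to control phases modulo a multiple of the period *)

Section Pump.
Variables (s D l : nat).
Hypotheses (D_gt0 : 0 < D) (sD : s %| D).
Hypotheses (loop_l : loop_length s l) (loop_ls : loop_length s (l + s)).
Hypothesis C_realized : forall c, C s c -> exists2 x, loop s x & c \in phased s r x.

Lemma loop_residue j : exists2 z, loop s z & size z = j * s %[mod D].
Proof.
(* The copies of [l] add up to a multiple of [D], which leaves [j * s]. *)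
have : loop_length s (j * (l + s) + j * D.-1 * l).
  by apply: loop_lengthD; apply: loop_lengthM.
case=> z hz sz; exists z; rewrite // sz.
have -> : j * (l + s) + j * D.-1 * l = j * l * D + j * s.
  by rewrite -(prednK D_gt0); lia.
by rewrite modnMDl.
Qed.

Lemma loop_phase T z : T = r %[mod s] -> loop s z -> T + size z = r %[mod s].
Proof.
move=> <- [_ sz _]; apply/eqP.
by rewrite -[X in _ == X %[mod _]]addn0 eqn_modDl mod0n.
Qed.

(** Some loop carries the letter at the right phase modulo [s]. A loop put in front of it, whose
    length modulo [D] is a chosen multiple of [s], moves that occurrence to the exact phase modulo
    [D]. *)
Lemma loop_through T c : T = r %[mod s] -> c.2 < D -> C s (reduce_phase s c) ->
  exists2 z, loop s z & c \in phased D T z.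
Proof.
move=> Tr cD /C_realized[x hx /mem_phased[u [a [v [xE [cE1 cE2]]]]]].
have [j hj] : exists j, T + size u + j * s = c.2 %[mod D].
  by apply: lift_mod => //; rewrite cE2 -modnDml Tr modnDml.
have [z hz sz] := loop_residue j; exists (z ++ x); first exact: loop_cat.
apply/mem_phased; exists (z ++ u), a, v; split; first by rewrite xE catA.
rewrite [c]surjective_pairing cE1; congr (_, _).
rewrite -[LHS](modn_small cD) -hj size_cat [size z + _]addnC addnA.
by apply/eqP; rewrite eqn_modDl sz.
Qed.

Lemma loop_spelling T v : T = r %[mod s] ->
  (forall c, c \in v -> c.2 < D /\ C s (reduce_phase s c)) ->
  exists2 z, loop s z & subseq v (phased D T z).
Proof.
elim: v T => [|c v IH] T Tr hv; first by exists [::] => //; split.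
have [cD hc] := hv c (mem_head _ _).
have [z hz cz] := loop_through Tr cD hc.
have [z' hz' vz'] : exists2 z', loop s z' & subseq v (phased D (T + size z) z').
  apply: IH; first exact: loop_phase.
  by move=> c' hc'; apply: hv; rewrite inE hc' orbT.
exists (z ++ z'); first exact: loop_cat.
by rewrite phased_cat -cat1s; apply: cat_subseq => //; rewrite sub1seq.
Qed.

(** Between [x1] and [x3] insert a loop that spells [n] copies of [L], which contain every word over
    [L] of length at most [n], and then a loop that corrects the total length modulo [D]. *)
Lemma pump p0 x1 x3 p' t T T1 n (L : seq (nat * nat)) :
  run tr p0 x1 p -> allowed s t x1 -> t + size x1 = r %[mod s] ->
  run tr p x3 p' -> allowed s r x3 ->
  T = t %[mod s] -> T1 = r + size x3 %[mod s] ->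
  (forall c, c \in L -> c.2 < D /\ C s (reduce_phase s c)) ->
  exists X, [/\ run tr p0 X p', allowed s T X, T + size X = T1 %[mod D] &
    forall v, all (mem L) v -> size v <= n -> subseq v (phased D T X)].
Proof.
move=> h1 a1 tr1 h3 a3 Tt T1r hL.
have Tx1 : T + size x1 = r %[mod s] by rewrite -modnDml Tt modnDml.
have [z hz Lz] : exists2 z, loop s z & subseq (block_power n L) (phased D (T + size x1) z).
  by apply: loop_spelling => // c /block_power_sub/hL.
have [j hj] : exists j, T + size x1 + size z + size x3 + j * s = T1 %[mod D].
  by apply: lift_mod => //; rewrite T1r -modnDml (loop_phase Tx1 hz) modnDml.
have [z' hz' sz'] := loop_residue j.
have [zrun _ zall] := loop_cat hz hz'.
exists (x1 ++ (z ++ z') ++ x3); split.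
- by apply/run_cat; exists p; split=> //; apply/run_cat; exists p.
- rewrite !allowed_cat; split; first exact: eq_allowed a1.
  split; first by apply/allowed_cat; apply: eq_allowed zall.
  by apply: eq_allowed a3; rewrite loop_phase //; exact: loop_cat.
- rewrite -hj !size_cat !addnA; apply/eqP.
  rewrite -!addnA !eqn_modDl [size x3 + _]addnC eqn_modDr; exact/eqP.
move=> v vL vn; apply: subseq_trans (subseq_block_power vL vn) _.
rewrite phased_cat phased_cat phased_cat; apply: subseq_trans (suffix_subseq _ _).
apply: subseq_trans (prefix_subseq _ _); apply: subseq_trans (prefix_subseq _ _).
exact: Lz.
Qed.

End Pump.
End LoopGcd.

(** * Change of modulus, and contents shared by loops of two automata *)

Lemma subseq_mapE (S T : eqType) (f : S -> T) x u :
  subseq x (map f u) -> exists2 y, subseq y u & x = map f y.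
Proof.
by move=> /subseqP[m sm ->]; exists (mask m u); rewrite ?mask_subseq ?map_mask.
Qed.

Lemma sim_map (S T : eqType) (f : S -> T) n u v :
  sim n u v -> sim n (map f u) (map f v).
Proof.
move=> uv x sx; apply/idP/idP => /subseq_mapE[y yu xE]; rewrite xE;
  by apply: map_subseq; rewrite ?uv // -?uv // -(size_map f) -xE.
Qed.

Lemma sim_phased_dvd s d n t t' u v : s %| d ->
  sim n (phased d t u) (phased d t' v) -> sim n (phased s t u) (phased s t' v).
Proof. by move=> sd h; rewrite -!(map_phased _ _ sd); apply: sim_map. Qed.

Lemma phased_take d t u i : phased d t (take i u) = take i (phased d t u).
Proof. by elim: u t i => [|a u IH] t [|i] //=; rewrite IH. Qed.

Lemma phased_drop d t u i : i <= size u ->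
  phased d (t + i) (drop i u) = drop i (phased d t u).
Proof.
elim: u t i => [|a u IH] t [|i] //=; rewrite ?addn0 // ltnS => iu.
by rewrite -IH // addnS addSn.
Qed.

(** Pairs of loops with equal content can be concatenated, so over a finite alphabet the union of
    all these contents is itself one of them: the set [C_s] of the overview. *)
Definition common_content tr1 p1 r1 tr2 p2 r2 s (c : nat * nat) := exists x y,
  [/\ run tr1 p1 x p1 /\ s %| size x, run tr2 p2 y p2 /\ s %| size y,
      phased s r1 x =i phased s r2 y & c \in phased s r1 x].

Lemma common_content_sym tr1 p1 r1 tr2 p2 r2 s c :
  common_content tr1 p1 r1 tr2 p2 r2 s c -> common_content tr2 p2 r2 tr1 p1 r1 s c.
Proof.
move=> [x [y [hx hy xy cx]]]; by exists y, x; rewrite -xy; split.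
Qed.

(** Equality of the two predicates allows facts about the first automaton to be reused for the
    second with the same [C]. *)
Lemma common_content_symE tr1 p1 r1 tr2 p2 r2 :
  common_content tr1 p1 r1 tr2 p2 r2 = common_content tr2 p2 r2 tr1 p1 r1.
Proof.
by apply/funext => s; apply/funext => c; apply/propext; split; exact: common_content_sym.
Qed.

Lemma common_content_reduce tr1 p1 r1 tr2 p2 r2 s d c : s %| d ->
  common_content tr1 p1 r1 tr2 p2 r2 d c ->
  common_content tr1 p1 r1 tr2 p2 r2 s (reduce_phase s c).
Proof.
move=> sd [x [y [[hx dx] [hy dy] xy cx]]]; exists x, y.
rewrite !(dvdn_trans sd) //; split=> //.
  by rewrite -!(map_phased _ _ sd); exact: eq_mem_map.
by rewrite -(map_phased _ _ sd) map_f.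
Qed.

Lemma common_content_realized tr1 p1 r1 tr2 p2 r2 s c :
  common_content tr1 p1 r1 tr2 p2 r2 s c ->
  exists2 x, loop tr1 p1 r1 (common_content tr1 p1 r1 tr2 p2 r2) s x &
             c \in phased s r1 x.
Proof.
move=> [x [y [[hx sx] hy xy cx]]]; exists x => //; split=> // c' cx'.
by exists x, y.
Qed.

Lemma cat_subseqE (T : eqType) (x y U : seq T) : subseq (x ++ y) U ->
  exists u v, [/\ U = u ++ v, subseq x u & subseq y v].
Proof.
elim: U x => [|b U IH] [|a x] //= h; try by exists [::], (b :: U).
  by move: h => /eqP->; exists [::], [::].
move: h; have [ab|ab] := eqVneq a b => [/IH|/(IH (a :: x))] [u [v [-> xu yv]]];
  exists (b :: u), v; split=> //=; first by rewrite ab eqxx.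
by rewrite (negbTE ab).
Qed.

Lemma block_power_cuts (T : eqType) (B U : seq T) N :
  B != [::] -> subseq (block_power N B) U -> exists cut : nat -> nat,
  [/\ cut N <= size U, forall i, i < N -> cut i < cut i.+1 &
      forall i, i < N -> subseq B (take (cut i.+1 - cut i) (drop (cut i) U))].
Proof.
move=> B0; elim: N U => [|N IH] U; first by exists (fun=> 0).
move=> /cat_subseqE[u [v [-> Bu /IH[cut [cutN cutS cutB]]]]].
exists (fun i => if i is i'.+1 then size u + cut i' else 0); split.
- by rewrite size_cat leq_add2l.
- case=> [_|i iN]; last by rewrite ltn_add2l cutS.
  by apply: leq_trans (leq_addr _ _); apply: leq_trans (size_subseq Bu); case: (B) B0.
case=> [_|i iN].
  rewrite drop0 subn0; apply: subseq_trans Bu _.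
  by rewrite take_cat ltnNge leq_addr /= prefix_subseq.
by rewrite subnDl drop_cat ltnNge leq_addr /= addKn cutB.
Qed.

(** Pigeonhole on state and phase at the ends of the [N] copies of [B]: two ends agree, and the
    cycle between them contains a whole copy of [B], so its content is exactly [B]. *)
Lemma block_cycle tr (Q : seq nat) q u q' t d N (B : seq (nat * nat)) :
  (forall p a q, tr p a q -> q \in Q) -> 0 < d ->
  run tr q u q' -> size Q * d < N -> B != [::] ->
  fills_atom N (Star B) (phased d t u) ->
  exists x1 x2 x3 p, [/\ u = x1 ++ x2 ++ x3,
    [/\ run tr q x1 p, run tr p x2 p & run tr p x3 q'],
    0 < size x2, d %| size x2 & phased d (t + size x1) x2 =i B].
Proof.
move=> trQ d_gt0 hu QN B0 [uB /(block_power_cuts B0)[cut [cutN cutS cutB]]].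
rewrite size_phased in cutN.
have [rho [rho0 rhou rhorun]] := run_trace hu.
have cut_lt i j : i < j <= N -> cut i < cut j.
  move=> /andP[]; elim: j => // j IH; rewrite ltnS leq_eqVlt => /orP[/eqP->|ij] jN.
    exact: cutS.
  by apply: ltn_trans (IH ij (ltnW jN)) (cutS _ jN).
have cut_le i : i <= N -> cut i <= size u.
  rewrite leq_eqVlt => /orP[/eqP->//|iN]; apply: leq_trans cutN; apply: ltnW.
  by rewrite cut_lt // iN /=.
have cut_gt0 i : 0 < i <= N -> 0 < cut i.
  by move=> /cut_lt; case: (cut i).
(* Only the cuts from 1 on are compared: they lie after at least one letter, so their states are
   targets of transitions. *)
pose mark i := (rho (cut i), (t + cut i) %% d).
have /(uniqPn (0, 0))[i [j [ij jN]]] : ~~ uniq [seq mark i | i <- iota 1 N].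
  apply: contraL QN => marks_uniq; rewrite -leqNgt.
  rewrite -(size_iota 1 N) -(size_map mark) -{1}(size_iota 0 d) -(size_allpairs pair).
  apply: uniq_leq_size marks_uniq _ => y /mapP[i]; rewrite mem_iota add1n ltnS => iN ->.
  rewrite allpairs_f ?mem_iota ?ltn_pmod //.
  have cu : cut i <= size u by rewrite cut_le //; case/andP: iN.
  apply: (run_mem trQ (rhorun 0 (cut i) cu)).
  by rewrite drop0 subn0 size_takel ?cut_gt0.
rewrite size_map size_iota in jN.
rewrite !(nth_map 0) ?size_iota ?(ltn_trans ij) // !nth_iota ?(ltn_trans ij) // !add1n.
move=> [rhoij /eqP phaseij].
have cij : cut i.+1 < cut j.+1 by apply: cut_lt; rewrite ltnS ij.
have cju : cut j.+1 <= size u by apply: cut_le.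
have ciu := leq_trans (ltnW cij) cju.
exists (take (cut i.+1) u), (take (cut j.+1 - cut i.+1) (drop (cut i.+1) u)),
  (drop (cut j.+1) u), (rho (cut i.+1)).
have sz : size (take (cut j.+1 - cut i.+1) (drop (cut i.+1) u)) = cut j.+1 - cut i.+1.
  by rewrite size_takel // size_drop leq_sub2r.
rewrite sz subn_gt0 cij size_takel //; split=> //.
- rewrite -{1}(cat_take_drop (cut i.+1) u); congr (_ ++ _).
  rewrite -{1}(cat_take_drop (cut j.+1 - cut i.+1) (drop _ u)); congr (_ ++ _).
  by rewrite drop_drop subnK // ltnW.
- split.
  + by have := rhorun 0 (cut i.+1); rewrite drop0 subn0 rho0; apply; rewrite ciu.
  + by rewrite {2}rhoij; apply: rhorun; rewrite (ltnW cij).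
  have := rhorun (cut j.+1) (size u); rewrite rhou rhoij cju leqnn => /(_ isT).
  by rewrite take_oversize // size_drop.
- by rewrite -(eqn_mod_dvd d (ltnW cij)) -(eqn_modDl t) eq_sym.
rewrite phased_take phased_drop // => c; apply/idP/idP => [/mem_take/mem_drop cu|cB].
  exact: (allP uB).
have /mem_subseq/(_ c cB) := cutB i.+1 (leq_ltn_trans ij jN).
(* The cycle covers the whole stretch between the cuts [i.+1] and [i.+2]. *)
have cc : cut i.+2 <= cut j.+1.
  have [<-//|ij'] := eqVneq i.+1 j; apply: ltnW; apply: cut_lt; rewrite ltnS jN andbT.
  by rewrite ltn_neqAle ij' ij.
rewrite -[in X in _ -> X](cat_take_drop (cut i.+2 - cut i.+1) (take _ _)) mem_cat.
by rewrite take_takel ?leq_sub2r // => ->.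
Qed.

(** * From one pair of equivalent runs to pairs equivalent for every modulus and length *)

Section TwoAutomata.
Variables (tr1 tr2 : transitions) (Q1 Q2 : seq nat) (k : nat).
Hypothesis tr1_states : forall p a q, tr1 p a q -> q \in Q1.
Hypothesis tr2_states : forall p a q, tr2 p a q -> q \in Q2.
Hypothesis tr1_letters : forall p a q, tr1 p a q -> a < k.
Hypothesis tr2_letters : forall p a q, tr2 p a q -> a < k.

Notation M := (size Q1 + size Q2).
(** The period starts at 1 and is multiplied by at most [m] whenever a recurrent state is lost,
    which happens at most [m] times. Every period met is thus at most [m ^ m] and divides this
    factorial. *)
Definition base_modulus m := (m ^ m)`!.
Notation d0 := (base_modulus M).

Lemma base_modulus_gt0 m : 0 < base_modulus m.
Proof. exact: fact_gt0. Qed.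

(** Apply [loop_dichotomy] to both automata. If either asks for a larger period, pass to it: its own
    count drops and the other does not increase. The given loops remain available at every period
    dividing [d0]. *)
Lemma common_period p1 r1 p2 r2 x0 y0 :
  let C := common_content tr1 p1 r1 tr2 p2 r2 in
  run tr1 p1 x0 p1 -> d0 %| size x0 -> run tr2 p2 y0 p2 -> d0 %| size y0 ->
  phased d0 r1 x0 =i phased d0 r2 y0 -> 0 < size x0 -> 0 < size y0 ->
  exists s, [/\ 0 < s, s %| d0,
    exists l, loop_length tr1 p1 r1 C s l /\ loop_length tr1 p1 r1 C s (l + s) &
    exists l, loop_length tr2 p2 r2 C s l /\ loop_length tr2 p2 r2 C s (l + s)].
Proof.
move=> C hx dx hy dy xy x_gt0 y_gt0.
have Cred s d c : s %| d -> C d c -> C s (reduce_phase s c).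
  exact: common_content_reduce.
have M_gt0 : 0 < M by have := run_mem tr1_states hx x_gt0; case: (Q1).
have in_d0 s : 0 < s -> s <= M ^ M -> s %| d0 by move=> *; apply: dvdn_fact; apply/andP.
have reduced s : s %| d0 -> phased s r1 x0 =i phased s r2 y0.
  by move=> sd; rewrite -!(map_phased _ _ sd); exact: eq_mem_map.
have loopx s : s %| d0 -> loop_length tr1 p1 r1 C s (size x0).
  move=> sd; exists x0 => //; split=> //; first exact: dvdn_trans dx.
  by move=> c cx; exists x0, y0; split=> //; [split|split|exact: reduced];
    rewrite // ?(dvdn_trans sd).
have loopy s : s %| d0 -> loop_length tr2 p2 r2 C s (size y0).
  move=> sd; exists y0 => //; split=> //; first exact: dvdn_trans dy.
  move=> c cy; exists x0, y0; split; [split|split|exact: reduced|];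
    rewrite // ?(dvdn_trans sd) //.
  by rewrite reduced.
pose count1 := recurrent_count tr1 Q1 p1 r1 C.
pose count2 := recurrent_count tr2 Q2 p2 r2 C.
(* The invariant trades each factor of the period, at most [M], for one lost recurrent state. It
   keeps [s] at most [M ^ M]. *)
suff H F s : 0 < s -> s * M ^ (count1 s + count2 s) <= M ^ M -> count1 s + count2 s < F ->
  exists s, [/\ 0 < s, s %| d0,
    exists l, loop_length tr1 p1 r1 C s l /\ loop_length tr1 p1 r1 C s (l + s) &
    exists l, loop_length tr2 p2 r2 C s l /\ loop_length tr2 p2 r2 C s (l + s)].
  apply: (H (count1 1 + count2 1).+1 1) => //; rewrite mul1n leq_pexp2l //.
  by apply: leq_add; exact: count_size.
have grow c s' : 2 <= c <= M -> 0 < s' -> s' * M ^ (count1 s' + count2 s') <= M ^ M ->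
    count1 (c * s') + count2 (c * s') < count1 s' + count2 s' ->
    c * s' * M ^ (count1 (c * s') + count2 (c * s')) <= M ^ M.
  move=> /andP[_ cM] s'_gt0 h lt; apply: leq_trans h; rewrite -mulnA mulnCA leq_pmul2l //.
  apply: leq_trans (leq_mul cM (leqnn _)) _; rewrite -expnS leq_pexp2l //.
elim: F s => // F IH s s_gt0 sM sF.
have sd : s %| d0 by apply: in_d0 => //; apply: leq_trans sM; rewrite leq_pmulr // expn_gt0 M_gt0.
have sc c : s %| c * s by apply: dvdn_mull.
case: (loop_dichotomy tr1_states Cred s_gt0 x_gt0 (loopx s sd)) => [l1|[c [/andP[c2 cQ] ltc]]].
  case: (loop_dichotomy tr2_states Cred s_gt0 y_gt0 (loopy s sd)) => [l2|[c [/andP[c2 cQ] ltc]]].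
    by exists s.
  have lt : count1 (c * s) + count2 (c * s) < count1 s + count2 s.
    by rewrite -addnS leq_add // recurrent_count_dvd.
  apply: (IH (c * s)); last exact: leq_trans lt _.
    by rewrite muln_gt0 s_gt0 (ltnW c2).
  by apply: grow; rewrite ?c2 ?(leq_trans cQ) // leq_addl.
have lt : count1 (c * s) + count2 (c * s) < count1 s + count2 s.
  by rewrite -addSn leq_add // recurrent_count_dvd.
apply: (IH (c * s)); last exact: leq_trans lt _.
  by rewrite muln_gt0 s_gt0 (ltnW c2).
by apply: grow; rewrite ?c2 ?(leq_trans cQ) // leq_addr.
Qed.


(** Both runs contain cycles with content [B], and these have a common period [s]. Pumping there
    gives freedom modulo [D] in the start and end phases, which need only agree with the old ones
    modulo [d0]. *)
Lemma star_step B u w q1 q1' q2 q2' t t' N :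
  B != [::] -> size Q1 * d0 < N -> size Q2 * d0 < N ->
  run tr1 q1 u q1' -> run tr2 q2 w q2' ->
  fills_atom N (Star B) (phased d0 t u) -> fills_atom N (Star B) (phased d0 t' w) ->
  forall D n T1 T2 E1 E2, d0 %| D -> 0 < D ->
  T1 = t %[mod d0] -> T2 = t' %[mod d0] ->
  E1 = t + size u %[mod d0] -> E2 = t' + size w %[mod d0] ->
  exists X Y, [/\ run tr1 q1 X q1' /\ run tr2 q2 Y q2',
    T1 + size X = E1 %[mod D], T2 + size Y = E2 %[mod D] &
    sim n (phased D T1 X) (phased D T2 Y)].
Proof.
move=> B0 N1 N2 hu hw fu fw D n T1 T2 E1 E2 dD D_gt0 T1t T2t E1u E2w.
have [x1 [x2 [x3 [p1 [uE [r1 r2 r3] x2_gt0 dx2 x2B]]]]] :=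
  block_cycle tr1_states (base_modulus_gt0 M) hu N1 B0 fu.
have [y1 [y2 [y3 [p2 [wE [s1 s2 s3] y2_gt0 dy2 y2B]]]]] :=
  block_cycle tr2_states (base_modulus_gt0 M) hw N2 B0 fw.
have xy : phased d0 (t + size x1) x2 =i phased d0 (t' + size y1) y2.
  by move=> c; rewrite x2B y2B.
pose C := common_content tr1 p1 (t + size x1) tr2 p2 (t' + size y1).
have [s [s_gt0 sd [l [hl hls]] [l' [hl' hls']]]] :=
  common_period r2 dx2 s2 dy2 xy x2_gt0 y2_gt0.
have sD : s %| D := dvdn_trans sd dD.
have Cred s' d c : s' %| d -> C d c -> C s' (reduce_phase s' c).
  exact: common_content_reduce.
have Csym : C = common_content tr2 p2 (t' + size y1) tr1 p1 (t + size x1).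
  by rewrite /C common_content_symE.
have CB c : c \in B -> C s (reduce_phase s c).
  move=> cB; apply: (Cred _ _ _ sd); exists x2, y2; split=> //; by rewrite x2B.
have allowedB v t0 : {subset phased d0 t0 v <= B} -> allowed C s t0 v.
  by move=> vB c; rewrite -(map_phased _ _ sd) => /mapP[c' /vB/CB hc ->].
have [/allP uB _] := fu; have [/allP wB _] := fw.
have mod_s a b : a = b %[mod d0] -> a = b %[mod s].
  by move=> ab; rewrite -(modn_dvdm a sd) ab modn_dvdm.
(* Both pumped words use only letters of [L] and contain every word over [L] of length at most [n],
   so they have the same short subwords. *)
pose L := [seq c <- phased_letters k D | `[< C s (reduce_phase s c) >]].
have inL T X q q' tr : (forall p a q, tr p a q -> a < k) -> run tr q X q' ->
    allowed C s T X -> {subset phased D T X <= L}.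
  move=> trk hX aX c cX; rewrite mem_filter; apply/andP; split.
    by apply/asboolP/aX; rewrite -(map_phased _ _ sD) map_f.
  by apply: phased_lettersP cX => //; exact: run_word_over hX.
have hL c : c \in L -> c.2 < D /\ C s (reduce_phase s c).
  rewrite mem_filter => /andP[/asboolP hc /allpairsP[[a b] [_ /= hb cE]]].
  by split=> //; move: hb; rewrite mem_iota cE.
(* Removing the cycle [v] does not change phases modulo [d0]. *)
have allowed_ends (x v y : seq nat) t0 : {subset phased d0 t0 (x ++ v ++ y) <= B} ->
    d0 %| size v -> allowed C s t0 x /\ allowed C s (t0 + size x) y.
  move=> h dv; split; apply: allowedB => c hc; apply: h; rewrite !phased_cat !mem_cat.
    by rewrite hc.
  have e : t0 + size x + size v = t0 + size x %[mod d0].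
    by apply/eqP; rewrite -[X in _ == X %[mod _]]addn0 eqn_modDl mod0n.
  by rewrite (eq_phased _ e) hc !orbT.
have endpoint (x v y : seq nat) t0 E : E = t0 + size (x ++ v ++ y) %[mod d0] ->
    d0 %| size v -> E = t0 + size x + size y %[mod s].
  move=> /mod_s -> /(dvdn_trans sd) sv; rewrite !size_cat !addnA.
  apply/eqP; rewrite eqn_modDr -[X in _ == X %[mod _]]addn0 eqn_modDl mod0n; exact: sv.
rewrite uE in uB E1u; rewrite wE in wB E2w.
have [ax1 ax3] := allowed_ends x1 x2 x3 t uB dx2.
have [ay1 ay3] := allowed_ends y1 y2 y3 t' wB dy2.
have real1 c : C s c -> exists2 x, loop tr1 p1 (t + size x1) C s x & c \in phased s (t + size x1) x.
  exact: common_content_realized.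
have real2 c : C s c -> exists2 x, loop tr2 p2 (t' + size y1) C s x & c \in phased s (t' + size y1) x.
  by rewrite Csym; exact: common_content_realized.
have [X [hX aX eX LX]] := pump D_gt0 sD hl hls real1 n r1 ax1 (erefl _) r3 ax3
  (mod_s _ _ T1t) (endpoint _ _ _ _ _ E1u dx2) hL.
have [Y [hY aY eY LY]] := pump D_gt0 sD hl' hls' real2 n s1 ay1 (erefl _) s3 ay3
  (mod_s _ _ T2t) (endpoint _ _ _ _ _ E2w dy2) hL.
have XL := inL _ _ _ _ _ tr1_letters hX aX; have YL := inL _ _ _ _ _ tr2_letters hY aY.
exists X, Y; split=> // v vn; have [vL|nvL] := boolP (all (mem L) v).
  by rewrite LX ?LY.
by apply/idP/idP => /mem_subseq vX; case/negP: nvL; apply/allP => c /vX; [exact: XL|exact: YL].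
Qed.

(** Induction over the atoms. At a letter atom the old phases agree modulo [d0], and the new ones
    must agree modulo [D]; hence the alignment hypothesis on [T1] and [T2]. Letters preserve
    alignment, and stars can restore it by the choice of end phases. *)
Lemma template_step P u w q1 q1' q2 q2' t t' N :
  size Q1 * d0 < N -> size Q2 * d0 < N ->
  run tr1 q1 u q1' -> run tr2 q2 w q2' ->
  product (fills_atom N) P (phased d0 t u) -> product (fills_atom N) P (phased d0 t' w) ->
  forall D n T1 T2, d0 %| D -> 0 < D ->
  T1 = t %[mod d0] -> T2 = t' %[mod d0] ->
  (t = t' %[mod d0] -> T1 = T2 %[mod D]) ->
  exists X Y, [/\ run tr1 q1 X q1' /\ run tr2 q2 Y q2',
    t + size u = t' + size w %[mod d0] -> T1 + size X = T2 + size Y %[mod D] &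
    sim n (phased D T1 X) (phased D T2 Y)].
Proof.
move=> N1 N2; elim: P u w q1 q2 t t' => [|A P IH] u w q1 q2 t t' hu hw.
  case: u hu => // hu; case: w hw => // hw _ _ D n T1 T2 _ _ _ _ aligned.
  by exists [::], [::]; rewrite /= !addn0.
have split_phased v t0 a b : phased d0 t0 v = a ++ b -> exists va vb,
    [/\ v = va ++ vb, phased d0 t0 va = a & phased d0 (t0 + size va) vb = b].
  move=> e; exists (take (size a) v), (drop (size a) v).
  have sa : size a <= size v by rewrite -(size_phased d0 t0) e size_cat leq_addr.
  rewrite cat_take_drop phased_take size_takel // phased_drop // e.
  by rewrite take_size_cat // drop_size_cat.
move=> [a [b [/split_phased[ua [ub [uE <- <-]]] fua fub]]].
move=> [a' [b' [/split_phased[wa [wb [wE <- <-]]] fwa fwb]]].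
move=> D n T1 T2 dD D_gt0 T1t T2t aligned.
subst u w; move: hu hw => /run_cat[p1 [hua hub]] /run_cat[p2 [hwa hwb]].
suff [X [Y [[hX hY] eX eY [al XY]]]] : exists X Y, [/\ run tr1 q1 X p1 /\ run tr2 q2 Y p2,
    T1 + size X = t + size ua %[mod d0], T2 + size Y = t' + size wa %[mod d0] &
    (t + size ua = t' + size wa %[mod d0] -> T1 + size X = T2 + size Y %[mod D]) /\
    sim n (phased D T1 X) (phased D T2 Y)].
  have [X' [Y' [[hX' hY'] al' XY']]] := IH _ _ _ _ _ _ hub hwb fub fwb D n _ _ dD D_gt0 eX eY al.
  exists (X ++ X'), (Y ++ Y'); rewrite !size_cat !addnA; split=> //.
    by split; apply/run_cat; [exists p1|exists p2].
  by rewrite !phased_cat; exact: sim_cat.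
have mod_d0 x y : x = y %[mod D] -> x = y %[mod d0].
  by move=> xy; rewrite -(modn_dvdm x dD) xy modn_dvdm.
case: A fua fwa {IH fub fwb} => [[c r]|B] fua fwa.
  move: fua fwa; case: ua hua => [|x [|//]] //= hua [xc tr].
  case: wa hwa => [|y [|//]] //= hwa [yc tr'].
  have tt' : t = t' %[mod d0] by rewrite tr tr'.
  exists [:: x], [:: y]; split=> //=; try by rewrite -modnDml ?T1t ?T2t modnDml.
  split; last by rewrite xc yc (aligned tt').
  by move=> _; rewrite -modnDml (aligned tt') modnDml.
(* A star over the empty alphabet has an empty block and offers no cycle to pump. *)
have [B0|B0] := eqVneq B [::].
  have nilE v t0 : fills_atom N (Star B) (phased d0 t0 v) -> v = [::].
    by rewrite B0; case: v => //= ? ? [].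
  rewrite (nilE _ _ fua) /= in hua *; rewrite (nilE _ _ fwa) /= in hwa *.
  by exists [::], [::]; rewrite /= !addn0.
(* The two end phases are made equal modulo [D] as soon as they agree modulo [d0]. *)
pose E2 := if t + size ua == t' + size wa %[mod d0] then t + size ua else t' + size wa.
have E2w : E2 = t' + size wa %[mod d0] by rewrite /E2; case: ifP => // /eqP.
have [X [Y [hXY eX eY XY]]] :=
  star_step B0 N1 N2 hua hwa fua fwa n dD D_gt0 T1t T2t (erefl _) E2w.
exists X, Y; split=> //; first exact: mod_d0.
  by rewrite -E2w; exact: mod_d0.
by split=> // al; rewrite eX eY /E2 al eqxx.
Qed.

End TwoAutomata.

Definition type_equiv d n w w' :=
  size w = size w' %[mod d] /\ sim n (phased d 1 w) (phased d 1 w').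

(** One more than the weight of the initial product: a single star over the [k * base_modulus m]
    tagged letters, with the block exponent [N] that [block_cycle] requires. *)
Definition base_rank k m :=
  (star_weight (m * base_modulus m).+1 (k * base_modulus m)).+1.

Lemma type_equiv_transfer tr1 tr2 (Q1 Q2 : seq nat) k u w q1 q1' q2 q2' d n :
  (forall p a q, tr1 p a q -> q \in Q1 /\ a < k) ->
  (forall p a q, tr2 p a q -> q \in Q2 /\ a < k) ->
  let m := size Q1 + size Q2 in
  run tr1 q1 u q1' -> run tr2 q2 w q2' ->
  type_equiv (base_modulus m) (base_rank k m) u w -> 0 < d ->
  exists X Y, [/\ run tr1 q1 X q1', run tr2 q2 Y q2' & type_equiv d n X Y].
Proof.
move=> h1 h2 m hu hw [suw uw] d_gt0.
pose N := (m * base_modulus m).+1; set d0 := base_modulus m in suw uw *.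
pose G := phased_letters k d0.
have inG tr q v q' : (forall p a q, tr p a q -> a < k) -> run tr q v q' ->
    product (@in_atom _) [:: Star G] (phased d0 1 v).
  move=> trk hv; exists (phased d0 1 v), [::]; rewrite cats0; split=> //; apply/allP.
  by apply: phased_lettersP; [exact: base_modulus_gt0|exact: run_word_over hv].
have [P [Pu Pw]] : exists P, product (fills_atom N) P (phased d0 1 u) /\
    product (fills_atom N) P (phased d0 1 w).
  apply: (common_template (P := [:: Star G]) _ uw).
  - by rewrite /weight big_seq1 /= size_allpairs !size_iota.
  - by apply: inG hu => p a q /h1[].
  - by apply: inG hw => p a q /h2[].
have NQ Q' : Q' <= m -> Q' * d0 < N by move=> Qm; rewrite ltnS leq_mul2r Qm orbT.
have s1 p a q : tr1 p a q -> q \in Q1 by move=> /h1[].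
have s2 p a q : tr2 p a q -> q \in Q2 by move=> /h2[].
have l1 p a q : tr1 p a q -> a < k by move=> /h1[].
have l2 p a q : tr2 p a q -> a < k by move=> /h2[].
(* The product is a multiple of [d0], as the template argument asks, and of [d], the modulus wanted
   in the end. *)
have D_gt0 : 0 < d0 * d by rewrite muln_gt0 base_modulus_gt0.
have [X [Y [[hX hY] eXY XY]]] := template_step s1 s2 l1 l2
  (NQ _ (leq_addr _ _)) (NQ _ (leq_addl _ _)) hu hw Pu Pw n (T1 := 1) (T2 := 1)
  (dvdn_mulr d (dvdnn _)) D_gt0 (erefl _) (erefl _) (fun _ => erefl _).
exists X, Y; split=> //; split; last exact: sim_phased_dvd (dvdn_mull d0 (dvdnn d)) XY.
have /eXY/eqP : 1 + size u = 1 + size w %[mod d0] by apply/eqP; rewrite eqn_modDl; apply/eqP.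
rewrite eqn_modDl => /eqP e.
by rewrite -(modn_dvdm (size X) (dvdn_mull d0 (dvdnn d))) e modn_dvdm // dvdn_mull.
Qed.

(** The bound on [a] is included because an automaton may have transitions on letters outside the
    alphabet. *)
Definition nfa_tr k A : transitions := fun p a q => (p, a, q) \in n_trans A /\ a < k.

(** The pigeonhole arguments only look at states reached after at least one letter, so the number of
    transitions serves as the number of states. *)
Definition nfa_targets A := [seq t.2 | t <- n_trans A].

Lemma nfa_tr_targets k A p a q : nfa_tr k A p a q -> q \in nfa_targets A /\ a < k.
Proof. by move=> [h ->]; split=> //; exact: (map_f snd h). Qed.

Lemma nfa_langE k A w : nfa_lang k A w <->
  exists p q, [/\ p \in n_init A, q \in n_final A & run (nfa_tr k A) p w q].
Proof.
have foldE S q : word_over k w ->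
    q \in foldl (nfa_step A) S w <-> exists2 p, p \in S & run (nfa_tr k A) p w q.
  elim: w S => [|a w IH] S /=; first by move=> _; split=> [h|[p hp <-]] //; exists q.
  move=> /andP[ak /IH->]; split.
    move=> [p1 /mapP[[[p b] p2]]]; rewrite mem_filter /= => /andP[/andP[pS /eqP->] h] -> hr.
    by exists p => //; exists p2.
  move=> [p pS [p1 [[h _] hr]]]; exists p1 => //; apply/mapP; exists (p, a, p1) => //.
  by rewrite mem_filter pS eqxx.
split=> [[wk /hasP[q hq qF]]|[p [q [pI qF hr]]]].
  by move: hq; rewrite foldE // => -[p pI hr]; exists p, q.
have wk : word_over k w by apply: run_word_over hr => ? ? ? [].
by split=> //; apply/hasP; exists q => //; apply/foldE => //; exists p.
Qed.

(** * Sentences and types *)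

Definition marked d w p : nat * nat := (nth 0 w p.-1, p %% d).

Lemma phased1E d w : phased d 1 w = [seq marked d w p | p <- iota 1 (size w)].
Proof.
have gen t : phased d t w = [seq (nth 0 w (p - t), p %% d) | p <- iota t (size w)].
  elim: w t => //= a w IH t; rewrite subnn IH; congr (_ :: _).
  apply/eq_in_map => p; rewrite mem_iota => /andP[tp _].
  by rewrite -[p - t]prednK ?subn_gt0 //= -subnS.
rewrite gen; apply/eq_in_map => p; rewrite mem_iota => /andP[p1 _].
by rewrite /marked subn1.
Qed.

Definition in_word (w : seq nat) p := 1 <= p <= size w.

Lemma subseq_phased1 d w x : subseq x (phased d 1 w) <->
  exists vs, [/\ sorted ltn vs, all (in_word w) vs & x = map (marked d w) vs].
Proof.
rewrite phased1E; split.
  move=> /subseq_mapE[vs vsw ->]; exists vs; split=> //.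
    exact: subseq_sorted ltn_trans _ _ vsw (iota_ltn_sorted 1 _).
  by apply/allP => p /(mem_subseq vsw); rewrite mem_iota add1n ltnS.
move=> [vs [vs_sorted vsw ->]]; apply: map_subseq.
suff -> : vs = [seq p <- iota 1 (size w) | p \in vs] by exact: filter_subseq.
apply: (irr_sorted_eq ltn_trans ltnn) => //.
  exact/(sorted_filter ltn_trans)/iota_ltn_sorted.
move=> p; rewrite mem_filter mem_iota add1n ltnS.
by case: (boolP (p \in vs)) => //= /(allP vsw) pw; exact/esym.
Qed.

(** The witnesses, sorted without repetition, spell a tagged subword of [w] of length at most the
    number of variables. An occurrence of it in [w'] gives a map [h] of positions that preserves
    order, letters and residues, hence the truth of every atom. *)
Lemma type_equiv_sig1 d (s : sigma1) w w' :
  qf_wf d (s_nvars s) (s_body s) -> type_equiv d (s_nvars s) w w' ->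
  sig1_sat w s -> sig1_sat w' s.
Proof.
case: s => n f /= fwf [sww' ww'] [vs [/= svs vsw sat]].
pose us := sort leq (undup vs).
have us_sorted : sorted ltn us.
  by rewrite ltn_sorted_uniq_leq sort_uniq undup_uniq sort_sorted //; exact: leq_total.
have mem_us p : (p \in us) = (p \in vs) by rewrite mem_sort mem_undup.
have usw : all (in_word w) us by apply/allP => p; rewrite mem_us => /(allP vsw).
have su : size us <= n by rewrite size_sort -svs size_undup.
have : subseq (map (marked d w) us) (phased d 1 w) by apply/subseq_phased1; exists us.
rewrite ww' ?size_map // => /subseq_phased1[us' [us'_sorted us'w e]].
have sus' : size us' = size us by rewrite -(size_map (marked d w')) -e size_map.
pose h p := nth 0 us' (index p us).
exists (map h vs); split=> /=; first by rewrite size_map.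
  apply/allP => _ /mapP[p pvs ->]; apply: (allP us'w); apply: mem_nth.
  by rewrite sus' index_mem mem_us.
have h_marked p : p \in us -> marked d w' (h p) = marked d w p.
  move=> pus; have ip : index p us < size us by rewrite index_mem.
  rewrite -(nth_map 0 (0, 0)) ?sus' // -e (nth_map 0) // nth_index //.
have h_lt p q : p \in us -> q \in us -> (h p < h q) = (p < q).
  have lt_us p1 q1 : p1 \in us -> q1 \in us -> p1 < q1 -> h p1 < h q1.
    move=> pus qus pq; apply: (sorted_ltn_nth ltn_trans) => //; rewrite ?inE ?sus' ?index_mem //.
    rewrite ltnNge; apply: contraL pq; rewrite -leqNgt leq_eqVlt => /orP[/eqP e'|].
      by rewrite -(nth_index 0 pus) -(nth_index 0 qus) e'.
    by move=> /(sorted_ltn_index ltn_trans us_sorted _ _ qus pus)/ltnW.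
  move=> pus qus; apply/idP/idP; last exact: lt_us.
  move=> hpq; case: (ltngtP p q) => // [qp|pq]; last by rewrite pq ltnn in hpq.
  by have := ltn_trans hpq (lt_us _ _ qus pus qp); rewrite ltnn.
have h_eq p q : p \in us -> q \in us -> (h p == h q) = (p == q).
  move=> pus qus; have := h_lt _ _ pus qus; have := h_lt _ _ qus pus.
  by case: (ltngtP (h p) (h q)); case: (ltngtP p q).
have in_us i : i < n -> nth 0 vs i \in us by move=> ilt; rewrite mem_us mem_nth ?svs.
have hE i : i < n -> nth 0 (map h vs) i = h (nth 0 vs i) by move=> ilt; rewrite (nth_map 0) ?svs.
suff -> : qf_sat w' (nth 0 (map h vs)) f = qf_sat w (nth 0 vs) f by [].
elim: f fwf {sat} => [|t|g IH|g IHg g' IHg'|g IHg g' IHg'] //=.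
- case: t => [i j|i j|a i|d' r i|d' r] /=.
  + by move=> /andP[i1 j1]; rewrite !hE // h_lt ?in_us.
  + by move=> /andP[i1 j1]; rewrite !hE // h_eq ?in_us.
  + by move=> i1; rewrite hE //; have [-> _] := h_marked _ (in_us i i1).
  + by move=> /and3P[/eqP-> _ i1]; rewrite hE //; have [_ ->] := h_marked _ (in_us i i1).
  by move=> /andP[/eqP-> _]; rewrite sww'.
- by move=> /IH->.
- by move=> /andP[/IHg-> /IHg'->].
by move=> /andP[/IHg-> /IHg'->].
Qed.

Lemma type_equiv_sym d n w w' : type_equiv d n w w' -> type_equiv d n w' w.
Proof. by move=> [e s]; split; rewrite ?e //; apply: sim_sym. Qed.

Lemma type_equiv_leq d n n' w w' : n <= n' -> type_equiv d n' w w' -> type_equiv d n w w'.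
Proof. by move=> nn' [e s]; split=> // x xn; apply/s/leq_trans/nn'. Qed.

Fixpoint rank (f : bsigma1) : nat :=
  match f with
  | BSig s => s_nvars s
  | BNot g => rank g
  | BAnd g h | BOr g h => maxn (rank g) (rank h)
  end.

Lemma type_equiv_bsig d f w w' : bsig_wf d f -> type_equiv d (rank f) w w' ->
  bsig_sat w f <-> bsig_sat w' f.
Proof.
elim: f => [s|g IH|g IHg h IHh|g IHg h IHh] /=.
- by move=> wf ww'; split; apply: (type_equiv_sig1 wf) => //; exact: type_equiv_sym.
- by move=> /IH h /h[h1 h2]; split=> nh ?; apply: nh; auto.
- move=> /andP[/IHg hg /IHh hh] ww'.
  have [] := hg (type_equiv_leq (leq_maxl _ _) ww').
  have [] := hh (type_equiv_leq (leq_maxr _ _) ww'); tauto.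
move=> /andP[/IHg hg /IHh hh] ww'.
have [] := hg (type_equiv_leq (leq_maxl _ _) ww').
have [] := hh (type_equiv_leq (leq_maxr _ _) ww'); tauto.
Qed.

(** * Building a separator from sentences about tagged subwords *)

Lemma mem_In (T : eqType) (x : T) s : x \in s -> List.In x s.
Proof. by elim: s => //= y s IH; rewrite inE => /orP[/eqP->|/IH]; [left|right]. Qed.

(* Induction on [fs]: a separator is [(f /\ g1) \/ (~ f /\ g2)], where [g1] and [g2]
   separate the parts of [K] and [L] inside and outside [f]. *)
Lemma separate_by d (fs : seq bsigma1) (K L : seq nat -> Prop) :
  all (bsig_wf d) fs ->
  (forall w w', K w -> L w' ->
     ~ (forall f, List.In f fs -> bsig_sat w f <-> bsig_sat w' f)) ->
  exists2 f, bsig_wf d f & forall w, (K w -> bsig_sat w f) /\ (L w -> ~ bsig_sat w f).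
Proof.
elim: fs K L => [|f fs IH] K L /=.
  move=> _ KL; pose t := BSig (Sig1 0 QTrue).
  have sat_t w : bsig_sat w t by exists [::].
  have [[w0 Kw0]|nK] := EM (exists w, K w).
    by exists t => // w; split=> [_|Lw]; [exact: sat_t|case: (KL w0 w Kw0 Lw) => f []].
  by exists (BNot t) => // w; split=> [Kw|_ h]; [case: nK; exists w|exact: (h (sat_t w))].
move=> /andP[wf /IH{}IH] KL.
have [|g1 wf1 h1] := IH (fun w => K w /\ bsig_sat w f) (fun w => L w /\ bsig_sat w f).
- move=> w w' [Kw wf1] [Lw' wf1'] e; apply: (KL w w') => // g [<-|/e//].
  by split.
have [|g2 wf2 h2] := IH (fun w => K w /\ ~ bsig_sat w f) (fun w => L w /\ ~ bsig_sat w f).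
- move=> w w' [Kw wf1'] [Lw' wf1''] e; apply: (KL w w') => // g [<-|/e//].
  by split.
exists (BOr (BAnd f g1) (BAnd (BNot f) g2)); first by rewrite /= wf wf1 wf2.
move=> w; have [h11 h12] := h1 w; have [h21 h22] := h2 w => /=.
have [] := EM (bsig_sat w f); tauto.
Qed.

(** Well-formed sentences name residues from 1 to [d], so the tag 0 is written [d]. *)
Definition letter_formula d i (c : nat * nat) :=
  QAnd (QAtom (ALet c.1 i)) (QAtom (AMod d (if c.2 == 0 then d else c.2) i)).

(** The last letter gets no order atom, since the next variable is not quantified. *)
Fixpoint spelling_formula d i (x : seq (nat * nat)) : qf :=
  if x is c :: x' then
    QAnd (letter_formula d i c)
      (QAnd (if x' is [::] then QTrue else QAtom (ALt i i.+1)) (spelling_formula d i.+1 x'))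
  else QTrue.

Lemma spelling_formula_wf d i x n : 0 < d -> i + size x <= n ->
  (forall c, c \in x -> c.2 < d) -> qf_wf d n (spelling_formula d i x).
Proof.
move=> d_gt0; elim: x i => //= c x IH i; rewrite addnS => ix xd.
have i_lt : i < n by apply: leq_trans ix; rewrite ltnS leq_addr.
have cd := xd c (mem_head _ _).
rewrite IH ?i_lt ?eqxx ?andbT /=; last 2 first.
- by rewrite addSn.
- by move=> c' c'x; apply: xd; rewrite inE c'x orbT.
apply/andP; split; first by case: eqP => [_|/eqP c0]; rewrite ?leqnn ?d_gt0 // lt0n c0 ltnW.
by case: x ix {IH xd} => //= c' x; rewrite addnS => ix; rewrite i_lt /=; lia.
Qed.

(** The values [vs0] of the earlier variables are carried along because the induction shifts the
    variable index. *)
Lemma spelling_formula_sat d w vs0 vs x :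
  (forall c, c \in x -> c.2 < d) -> size vs = size x ->
  qf_sat w (nth 0 (vs0 ++ vs)) (spelling_formula d (size vs0) x) =
  sorted ltn vs && (map (marked d w) vs == x).
Proof.
elim: x vs0 vs => [|c x IH] vs0 [|v vs] //= xd [svs].
have cd := xd c (mem_head _ _).
have -> : (size vs0).+1 = size (rcons vs0 v) by rewrite size_rcons.
rewrite -cat_rcons IH //; last by move=> c' c'x; apply: xd; rewrite inE c'x orbT.
rewrite size_rcons.
have nth_v l : nth 0 (rcons vs0 v ++ l) (size vs0) = v.
  by rewrite cat_rcons nth_cat ltnn subnn.
rewrite nth_v.
have -> : (v %% d == (if c.2 == 0 then d else c.2) %% d) = (v %% d == c.2).
  by case: (c.2 =P 0) => [->|_]; rewrite ?modnn // (modn_small cd).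
rewrite eqseq_cons -pair_eqE /=.
case: x vs svs {IH xd} => [|c' x] [|v' vs] //= [svs].
rewrite nth_v nth_cat size_rcons ltnn subnn /=.
set A := (nth 0 w _ == _) && _; set B := v < v'; set E := path _ _ _; set F := _ == _.
by case: A; case: B; case: E; case: F.
Qed.

Definition subword_sentence d x := BSig (Sig1 (size x) (spelling_formula d 0 x)).

Lemma subword_sentenceE d w x : (forall c, c \in x -> c.2 < d) ->
  bsig_sat w (subword_sentence d x) <-> subseq x (phased d 1 w).
Proof.
move=> xd; rewrite subseq_phased1; split=> /=.
  move=> [vs [/= svs vsw]]; rewrite (spelling_formula_sat w [::] xd svs) => /andP[vs_sorted /eqP<-].
  by exists vs.
move=> [vs [vs_sorted vsw xE]]; have svs : size vs = size x by rewrite xE size_map.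
exists vs; split=> //=; rewrite (spelling_formula_sat w [::] xd svs) vs_sorted xE; exact/eqP.
Qed.

Fixpoint words_upto (T : Type) (G : seq T) n : seq (seq T) :=
  if n is n'.+1 then [::] :: allpairs cons G (words_upto G n') else [:: [::]].

Lemma mem_words_upto (T : eqType) (G : seq T) n x :
  (x \in words_upto G n) = all (mem G) x && (size x <= n).
Proof.
elim: n x => [|n IH] [|c x] //=; first by rewrite andbF.
rewrite inE /=; apply/allpairsP/idP => [[[c' x'] [/= hc hx [-> ->]]]|].
  by move: hx; rewrite IH hc ltnS.
by rewrite ltnS -andbA => /andP[hc hx]; exists (c, x); rewrite IH.
Qed.

Lemma sim_words_upto (T : eqType) (G : seq T) n u v :
  {subset u <= G} -> {subset v <= G} ->
  {in words_upto G n, forall x, subseq x u = subseq x v} -> sim n u v.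
Proof.
move=> uG vG uv x xn; have [xG|nxG] := boolP (all (mem G) x).
  by apply: uv; rewrite mem_words_upto xG.
by apply/idP/idP => /mem_subseq xw; case/negP: nxG; apply/allP => c /xw; [exact: uG|exact: vG].
Qed.

(** From left to right, the rank of the separator serves as [n]. From right to left, agreement on
    the finitely many sentences [fs] forces equal types, so [separate_by] applies. *)
Lemma BSigma1MOD_separableE k (K L : seq nat -> Prop) :
  (forall w, K w -> word_over k w) -> (forall w, L w -> word_over k w) ->
  BSigma1MOD_separable k K L <->
  exists d n, 0 < d /\ forall w w', K w -> L w' -> ~ type_equiv d n w w'.
Proof.
move=> Kk Lk; split.
  move=> [d [f [d_gt0 [wf sep]]]]; exists d, (rank f); split=> // w w' Kw Lw' ww'.
  have [/(_ Kw) sat _] := sep w (Kk _ Kw); have [_ /(_ Lw')] := sep w' (Lk _ Lw').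
  by apply; apply/(type_equiv_bsig wf ww').
move=> [d [n [d_gt0 sep]]].
pose G := phased_letters k d.
pose fs := [seq subword_sentence d x | x <- words_upto G n] ++
           [seq BSig (Sig1 0 (QAtom (ALen d r))) | r <- iota 1 d].
have Gd x c : x \in words_upto G n -> c \in x -> c.2 < d.
  rewrite mem_words_upto => /andP[/allP xG _] /xG /allpairsP[[a b] [_ /= hb ->]].
  by move: hb; rewrite mem_iota.
have [||f wf hf] := @separate_by d fs K L.
- rewrite all_cat !all_map; apply/andP; split.
    by apply/allP => x hx; apply: spelling_formula_wf => // c; exact: Gd hx.
  by apply/allP => r; rewrite mem_iota /= eqxx add1n ltnS.
- move=> w w' Kw Lw' agree; apply: (sep w w' Kw Lw'); split.
    (* Again the residue 0 is named by [d]. *)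
    pose r := if size w %% d == 0 then d else size w %% d.
    have rE : r %% d = size w %% d by rewrite /r; case: eqP => [->|]; rewrite ?modnn ?modn_mod.
    have r_in : r \in iota 1 d.
      rewrite mem_iota add1n ltnS /r; case: eqP => [_|/eqP h]; first by rewrite d_gt0 /=.
      by rewrite lt0n h ltnW ?ltn_pmod.
    have [] := agree (BSig (Sig1 0 (QAtom (ALen d r)))).
      apply: List.in_or_app; right; apply: (List.in_map (fun r => BSig (Sig1 0 (QAtom (ALen d r))))).
      exact: mem_In.
    move=> /(_ _)[|vs [_ _ /=]]; first by exists [::]; split=> //=; rewrite rE.
    by rewrite rE => /eqP->.
  apply: (sim_words_upto (G := G)); try by apply: phased_lettersP => //; auto.
  move=> x hx; have : List.In (subword_sentence d x) fs.
    by apply: List.in_or_app; left; apply: List.in_map; exact: mem_In.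
  move=> /agree; rewrite !subword_sentenceE; try by move=> c; exact: Gd hx.
  by move=> h; apply/idP/idP => /h.
by exists d, f; split=> //; split.
Qed.

(** * A bounded separability test *)

Definition type_equivb k d n w w' :=
  (size w %% d == size w' %% d) &&
  all (fun x => subseq x (phased d 1 w) == subseq x (phased d 1 w'))
      (words_upto (phased_letters k d) n).

Lemma type_equivP k d n w w' : 0 < d -> word_over k w -> word_over k w' ->
  reflect (type_equiv d n w w') (type_equivb k d n w w').
Proof.
move=> d_gt0 wk w'k; apply: (iffP andP) => [[/eqP e /allP h]|[e h]]; split.
- exact: e.
- apply: (@sim_words_upto _ (phased_letters k d)); try exact: phased_lettersP.
  by move=> x /h /eqP.
- exact/eqP.
by apply/allP => x; rewrite mem_words_upto => /andP[_ xn]; rewrite h.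
Qed.

(** Counts the triples of a state, a residue and a number of short tagged subwords seen so far, as
    used for the pigeonhole in [short_run]. *)
Definition short_bound k d n m := m * d * (size (words_upto (phased_letters k d) n)).+1.

(** On a long run two prefixes share the state, the residue of the length and the number of short
    tagged subwords. The set of these subwords grows along the run, so equal numbers mean equal
    sets, and the factor between the two prefixes can be removed without changing the type. *)
Lemma short_run tr (Q : seq nat) k d n q u q' :
  (forall p a q, tr p a q -> q \in Q /\ a < k) -> 0 < d -> run tr q u q' ->
  exists u', [/\ run tr q u' q', type_equiv d n u u' & size u' <= short_bound k d n (size Q)].
Proof.
move=> trQ d_gt0; have trQ' p a r : tr p a r -> r \in Q by move=> /trQ[].
have trk p a r : tr p a r -> a < k by move=> /trQ[].
move: {2}(size u).+1 (ltnSn (size u)) => l.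
elim: l u => // l IH u ul hu; set b := short_bound _ _ _ _.
have [ub|bu] := leqP (size u) b; first by exists u; split=> //; split.
have [rho [rho0 rhou rhorun]] := run_trace hu.
pose Xs := words_upto (phased_letters k d) n.
pose sub i x := subseq x (phased d 1 (take i u)).
pose mark i := (rho i, i %% d, count (sub i) Xs).
have /(uniqPn (0, 0, 0))[i [j [ij]]] : ~~ uniq [seq mark i | i <- iota 1 (size u)].
  apply: contraL bu => marks_uniq; rewrite -leqNgt /b /short_bound.
  rewrite -(size_iota 1 (size u)) -(size_map mark) -{1}(size_iota 0 d) -(size_allpairs pair).
  rewrite -[(size _).+1](size_iota 0) -(size_allpairs pair).
  apply: uniq_leq_size marks_uniq _ => y /mapP[i]; rewrite mem_iota add1n ltnS => iu ->.
  have /andP[i_gt0 i_le] := iu.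
  apply: allpairs_f; last by rewrite mem_iota add0n ltnS count_size.
  apply: allpairs_f; last by rewrite mem_iota ltn_pmod.
  apply: (run_mem trQ' (rhorun 0 i i_le)).
  by rewrite drop0 subn0 size_takel.
rewrite size_map size_iota => ju.
rewrite !(nth_map 0) ?size_iota ?(ltn_trans ij) // !nth_iota ?(ltn_trans ij) // !add1n.
move=> [rhoij phaseij countij].
move: i.+1 j.+1 (ij : i.+1 < j.+1) ju rhoij phaseij countij => {}i {}j {}ij ju rhoij phaseij countij.
have iu := leq_trans (ltnW ij) ju.
have sub_mono x : sub i x -> sub j x.
  move=> /subseq_trans; apply; rewrite -(cat_take_drop i (take j u)) phased_cat.
  by rewrite take_takel ?prefix_subseq // ltnW.
have sub_eq : {in Xs, sub i =1 sub j}.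
  move=> x xXs; apply/idP/idP => [/sub_mono //|subj].
  apply: contraT => /(ltn_count sub_mono xXs subj).
  by rewrite countij ltnn.
have tE : 1 + i = 1 + j %[mod d] by apply/eqP; rewrite eqn_modDl; apply/eqP.
have hu' : run tr q (take i u ++ drop j u) q'.
  apply/run_cat; exists (rho i); split.
    by have := rhorun 0 i; rewrite drop0 subn0 rho0; apply; rewrite iu.
  have := rhorun j (size u); rewrite rhou -rhoij ju leqnn => /(_ isT).
  by rewrite take_oversize // size_drop.
have lt' : size (take i u ++ drop j u) < size u.
  by rewrite size_cat size_takel // size_drop; move: ij ju; lia.
have [u' [hru' [e1 s1] b1]] := IH _ (leq_trans lt' ul) hu'.
exists u'; split=> //; split.
  rewrite -e1 size_cat size_takel // size_drop -modnDml phaseij modnDml subnKC //.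
move=> x xn; rewrite -s1 // -{1}(cat_take_drop j u) !phased_cat !size_takel //.
rewrite (eq_phased _ tE); move: x xn; apply: sim_cat; last by [].
have ph_sub r : {subset phased d 1 (take r u) <= phased_letters k d}.
  apply: phased_lettersP => //; apply/allP => a /mem_take; exact: (allP (run_word_over trk hu)).
by apply: sim_words_upto (ph_sub j) (ph_sub i) _ => x /sub_eq.
Qed.

Definition separability_test k A B :=
  let m := size (n_trans A) + size (n_trans B) in
  let d := base_modulus m in
  let n := base_rank k m in
  let ws := words_upto (iota 0 k) (short_bound k d n m) in
  ~~ has (fun w => nfa_accepts A w &&
            has (fun w' => nfa_accepts B w' && type_equivb k d n w w') ws) ws.

Lemma word_over_iota k w : word_over k w = all (mem (iota 0 k)) w.
Proof. by apply: eq_all => a /=; rewrite mem_iota. Qed.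

(** If no short pair is equivalent, [short_run] excludes every equivalent pair, so [d] and [n]
    witness separability. If a short pair is found, [type_equiv_transfer] refutes every other choice
    of modulus and length. *)
Lemma separability_testP k A B :
  reflect (BSigma1MOD_separable k (nfa_lang k A) (nfa_lang k B)) (separability_test k A B).
Proof.
have trA := @nfa_tr_targets k A; have trB := @nfa_tr_targets k B.
have sA : size (nfa_targets A) = size (n_trans A) by rewrite size_map.
have sB : size (nfa_targets B) = size (n_trans B) by rewrite size_map.
pose m := size (n_trans A) + size (n_trans B); pose d := base_modulus m.
pose n := base_rank k m; pose b := short_bound k d n m.
rewrite /separability_test; cbv zeta; rewrite -/m -/d -/n -/b.
have d_gt0 : 0 < d by exact: base_modulus_gt0.
have b_mono m' : m' <= m -> short_bound k d n m' <= b.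
  by move=> m'm; rewrite /b /short_bound !leq_mul2r m'm !orbT.
apply: (equivP negP); rewrite BSigma1MOD_separableE; try by move=> w [].
split=> [none|[d' [n' [d'_gt0 sep]]] /hasP[w wws /andP[Aw /hasP[w' w'ws /andP[Bw' eq_ww']]]]].
  exists d, n; split=> // w w' /nfa_langE[p [q [pI qF hw]]] /nfa_langE[p' [q' [p'I q'F hw']]] ww'.
  have [u [hu [e1 s1] bu]] := short_run n trA d_gt0 hw.
  have [v [hv [e2 s2] bv]] := short_run n trB d_gt0 hw'.
  have [uk Au] : nfa_lang k A u by apply/nfa_langE; exists p, q.
  have [vk Bv] : nfa_lang k B v by apply/nfa_langE; exists p', q'.
  apply: none; apply/hasP; exists u.
    by rewrite mem_words_upto -word_over_iota uk (leq_trans bu) // b_mono // sA leq_addr.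
  rewrite Au; apply/hasP; exists v.
    by rewrite mem_words_upto -word_over_iota vk (leq_trans bv) // b_mono // sB leq_addl.
  rewrite Bv; apply/type_equivP => //; have [e3 s3] := ww'.
  by split=> [|x xn]; rewrite -?e1 ?e3 ?e2 // -s1 // s3 // s2.
move: wws w'ws; rewrite !mem_words_upto -!word_over_iota => /andP[wk _] /andP[w'k _].
have /nfa_langE[p [q [pI qF hw]]] : nfa_lang k A w by [].
have /nfa_langE[p' [q' [p'I q'F hw']]] : nfa_lang k B w' by [].
have /type_equivP ww' := eq_ww'.
have {ww'} := ww' d_gt0 wk w'k.
rewrite /n /d /m -sA -sB => ww'.
have [X [Y [hX hY XY]]] := type_equiv_transfer n' trA trB hw hw' ww' d'_gt0.
by apply: (sep X Y) => //; apply/nfa_langE; [exists p, q|exists p', q'].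
Qed.

(** * Recursive functions on encoded data *)

Definition pAdd := PRec (PProj 0) (PComp PSucc [:: PProj 1]).
Definition pTri := PRec PZero (PComp PSucc [:: PComp pAdd [:: PProj 0; PProj 1]]).
Definition pPair := PComp pAdd [:: PComp pTri [:: pAdd]; PProj 1].
Definition pPred := PRec PZero (PProj 0).
(** The subtrahend comes first, because recursion is on the head of the argument list. *)
Definition pSub := PRec (PProj 0) (PComp pPred [:: PProj 1]).
Definition pIsZero := PRec (PComp PSucc [:: PZero]) PZero.
(** Inverts Cantor pairing: the largest [r] whose triangular number is at most the argument, raised
    by one whenever the argument reaches the next triangular number. *)
Definition pRoot := PRec PZero
  (PComp pAdd [:: PProj 1; PComp pIsZero
     [:: PComp pSub [:: PComp PSucc [:: PProj 0]; PComp pTri [:: PComp PSucc [:: PProj 1]]]]]).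
Definition pSnd := PComp pSub [:: PComp pTri [:: pRoot]; PProj 0].
Definition pFst := PComp pSub [:: pSnd; pRoot].

Lemma eval_rec f g (b : nat) (s : nat -> nat -> nat) n xs :
  eval f xs b -> (forall i z, eval g [:: i, z & xs] (s i z)) ->
  eval (PRec f g) (n :: xs) (nat_rect (fun=> nat) b s n).
Proof.
move=> hf hg; elim: n => [|n IH] /=; first exact: eRec0.
by apply: eRecS; [by []|exact: IH|exact: hg].
Qed.

Lemma eval_comp1 f g xs y z : eval g xs y -> eval f [:: y] z -> eval (PComp f [:: g]) xs z.
Proof. by move=> hg hf; apply: eComp hf; apply: esCons hg (esNil _). Qed.

Lemma eval_comp2 f g h xs y y' z : eval g xs y -> eval h xs y' ->
  eval f [:: y; y'] z -> eval (PComp f [:: g; h]) xs z.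
Proof. by move=> hg hh hf; apply: eComp hf; apply: esCons hg (esCons hh (esNil _)). Qed.

Lemma eval_add a b xs : eval pAdd [:: a, b & xs] (a + b).
Proof.
have -> : a + b = nat_rect (fun=> nat) b (fun _ z => z.+1) a by elim: a => //= a <-.
apply: eval_rec => [|i z]; first exact: (eProj 0).
apply: eval_comp1; first exact: (eProj 1).
exact: (eSucc [:: z]).
Qed.

Fixpoint tri n := if n is n'.+1 then (n' + tri n').+1 else 0.

Lemma triE n : (n * n.+1)./2 = tri n.
Proof.
elim: n => // n IH; rewrite [tri _]/= -IH -[RHS]doubleK; congr half.
have := odd_double_half (n * n.+1); rewrite oddM oddS andbN /=; lia.
Qed.

Lemma eval_tri n xs : eval pTri (n :: xs) (tri n).
Proof.
have -> : tri n = nat_rect (fun=> nat) 0 (fun i z => (i + z).+1) n by elim: n => //= n <-.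
apply: eval_rec => [|i z]; first exact: eZero.
apply: eval_comp1; last exact: (eSucc [:: i + z]).
by apply: eval_comp2; [exact: (eProj 0)|exact: (eProj 1)|exact: eval_add].
Qed.

Lemma eval_pair a b xs : eval pPair [:: a, b & xs] (cpair a b).
Proof.
rewrite /cpair triE; apply: eval_comp2; last exact: eval_add.
  by apply: eval_comp1; [exact: eval_add|exact: eval_tri].
exact: (eProj 1).
Qed.

Lemma eval_pred n xs : eval pPred (n :: xs) n.-1.
Proof.
have -> : n.-1 = nat_rect (fun=> nat) 0 (fun i z => i) n by case: n.
by apply: eval_rec => [|i z]; [exact: eZero|exact: (eProj 0)].
Qed.

Lemma eval_sub a b xs : eval pSub [:: b, a & xs] (a - b).
Proof.
have -> : a - b = nat_rect (fun=> nat) a (fun _ z => z.-1) b by elim: b => [|b] /=; lia.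
apply: eval_rec => [|i z]; first exact: (eProj 0).
by apply: eval_comp1; [exact: (eProj 1)|exact: eval_pred].
Qed.

Lemma eval_is_zero n xs : eval pIsZero (n :: xs) (n == 0).
Proof.
have -> : nat_of_bool (n == 0) = nat_rect (fun=> nat) 1 (fun _ _ => 0) n by case: n.
apply: eval_rec => [|i z]; last exact: eZero.
by apply: eval_comp1; [exact: eZero|exact: (eSucc [:: 0])].
Qed.

Fixpoint root z := if z is z'.+1 then root z' + (tri (root z').+1 - z == 0) else 0.

Lemma eval_root z xs : eval pRoot (z :: xs) (root z).
Proof.
have -> : root z = nat_rect (fun=> nat) 0 (fun i r => r + (tri r.+1 - i.+1 == 0)) z.
  by elim: z => //= z <-.
apply: eval_rec => [|i r]; first exact: eZero.
apply: eval_comp2; [exact: (eProj 1)| |exact: eval_add].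
apply: eval_comp1; last exact: eval_is_zero.
apply: eval_comp2; last exact: eval_sub.
  by apply: eval_comp1; [exact: (eProj 0)|exact: (eSucc [:: i])].
apply: eval_comp1; last exact: eval_tri.
by apply: eval_comp1; [exact: (eProj 1)|exact: (eSucc [:: r])].
Qed.

Definition usnd z := z - tri (root z).
Definition ufst z := root z - usnd z.

Lemma eval_usnd z xs : eval pSnd (z :: xs) (usnd z).
Proof.
apply: eval_comp2; last exact: eval_sub; last exact: (eProj 0).
by apply: eval_comp1; [exact: eval_root|exact: eval_tri].
Qed.

Lemma eval_ufst z xs : eval pFst (z :: xs) (ufst z).
Proof. by apply: eval_comp2; [exact: eval_usnd|exact: eval_root|exact: eval_sub]. Qed.

Lemma root_bounds z : tri (root z) <= z < tri (root z).+1.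
Proof.
elim: z => //= z /andP[h1 h2] /=; move: h1 h2 => /=; case: eqP => /=; rewrite ?addn0 ?addn1 /=; lia.
Qed.

Lemma tri_mono m n : m <= n -> tri m <= tri n.
Proof. by move=> /subnK <-; elim: (n - m) => // p IH; apply: leq_trans IH _; rewrite addSn /=; lia. Qed.

(** Since [b <= a + b], the code lies between the consecutive triangular numbers of [a + b] and
    [(a + b).+1]. *)
Lemma root_cpair a b : root (cpair a b) = a + b.
Proof.
rewrite /cpair triE; have := root_bounds (tri (a + b) + b); set r := root _ => /andP[h1 h2].
have [rab|abr|//] := ltngtP r (a + b).
  by have := tri_mono rab; lia.
by have := tri_mono abr; rewrite /=; lia.
Qed.

Lemma usnd_cpair a b : usnd (cpair a b) = b.
Proof. by rewrite /usnd root_cpair /cpair triE addKn. Qed.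

Lemma ufst_cpair a b : ufst (cpair a b) = a.
Proof. by rewrite /ufst usnd_cpair root_cpair addnK. Qed.

Definition recursive (F : nat -> nat) := exists M, forall n, eval M [:: n] (F n).

Lemma recursive_id : recursive id.
Proof. by exists (PProj 0) => n; exact: (eProj 0). Qed.

Lemma recursive_comp F G : recursive F -> recursive G -> recursive (F \o G).
Proof. by move=> [M hM] [M' hM']; exists (PComp M [:: M']) => n; apply: eval_comp1. Qed.

Lemma recursive_const c : recursive (fun=> c).
Proof.
elim: c => [|c [M hM]]; first by exists PZero => n; exact: eZero.
exists (PComp PSucc [:: M]) => n; apply: eval_comp1; first exact: hM.
exact: (eSucc [:: c]).
Qed.

Lemma recursive_succ : recursive succn.
Proof. by exists PSucc => n; exact: (eSucc [:: n]). Qed.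

Lemma recursive_pair F G : recursive F -> recursive G -> recursive (fun n => cpair (F n) (G n)).
Proof.
move=> [M hM] [M' hM']; exists (PComp pPair [:: M; M']) => n.
by apply: eval_comp2; [exact: hM|exact: hM'|exact: eval_pair].
Qed.

Lemma recursive_ufst : recursive ufst.
Proof. by exists pFst => n; exact: eval_ufst. Qed.

Lemma recursive_usnd : recursive usnd.
Proof. by exists pSnd => n; exact: eval_usnd. Qed.

Lemma recursive_natrec B S N : recursive B -> recursive S -> recursive N ->
  recursive (fun n => nat_rect (fun=> nat) (B n) (fun i z => S (cpair n (cpair i z))) (N n)).
Proof.
move=> [MB hB] [MS hS] [MN hN].
(* The step of the recursion receives [i], [z] and [n] in this order and packs them into one number
   for the unary [S]. *)
exists (PComp (PRec MB (PComp MS [:: PComp pPair [:: PProj 2; pPair]])) [:: MN; PProj 0]) => n.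
apply: eval_comp2; [exact: hN|exact: (eProj 0)|].
apply: (eval_rec (s := fun i z => S (cpair n (cpair i z)))) => [|i z]; first exact: hB.
apply: eval_comp1; last exact: hS.
by apply: eval_comp2; [exact: (eProj 2)|exact: eval_pair|exact: eval_pair].
Qed.

(** * Computable functions between coded types *)

Class Code (T : Type) := code : T -> nat.
(** The instances reproduce the encoding in [enc_instance], and truth values are coded by the
    outputs 1 and 0 demanded of the decision procedure. *)
#[export] Instance code_nat : Code nat := id.
#[export] Instance code_bool : Code bool := nat_of_bool.
#[export] Instance code_prod A B `{Code A} `{Code B} : Code (A * B) :=
  fun p => cpair (code p.1) (code p.2).
#[export] Instance code_seq A `{Code A} : Code (seq A) := fun s => enc_seq (map code s).

(* [F] is total, also off the codes: case analysis is compiled to a recursion that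
   runs through numbers that code nothing. *)
Definition computable {X Y} `{Code X} `{Code Y} (f : X -> Y) :=
  exists F, recursive F /\ forall x, F (code x) = code (f x).

Section Computable.
Context {X Y Z A : Type} {cX : Code X} {cY : Code Y} {cZ : Code Z} {cA : Code A}.

Lemma computable_ext (f g : X -> Y) : f =1 g -> computable f -> computable g.
Proof. by move=> fg [F [hF FE]]; exists F; split=> // x; rewrite -fg. Qed.

Lemma computable_id : computable (fun x : X => x).
Proof. by exists id; split=> //; exact: recursive_id. Qed.

Lemma computable_const (y : Y) : computable (fun _ : X => y).
Proof. by exists (fun=> code y); split=> //; exact: recursive_const. Qed.

Lemma computable_comp (f : Y -> Z) (g : X -> Y) :
  computable f -> computable g -> computable (fun x => f (g x)).
Proof.
move=> [F [hF FE]] [G [hG GE]]; exists (F \o G); split; first exact: recursive_comp.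
by move=> x /=; rewrite GE FE.
Qed.

Lemma computable_pair (f : X -> Y) (g : X -> Z) :
  computable f -> computable g -> computable (fun x => (f x, g x)).
Proof.
move=> [F [hF FE]] [G [hG GE]]; exists (fun n => cpair (F n) (G n)).
by split=> [|x]; [exact: recursive_pair|rewrite FE GE].
Qed.

Lemma computable_fst (f : X -> Y * Z) : computable f -> computable (fun x => (f x).1).
Proof.
move=> [F [hF FE]]; exists (ufst \o F); split; last by move=> x /=; rewrite FE ufst_cpair.
exact: recursive_comp recursive_ufst hF.
Qed.

Lemma computable_snd (f : X -> Y * Z) : computable f -> computable (fun x => (f x).2).
Proof.
move=> [F [hF FE]]; exists (usnd \o F); split; last by move=> x /=; rewrite FE usnd_cpair.
exact: recursive_comp recursive_usnd hF.
Qed.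

Lemma computable_succ (f : X -> nat) : computable f -> computable (fun x => (f x).+1).
Proof.
move=> [F [hF FE]]; exists (succn \o F); split; last by move=> x /=; rewrite FE.
exact: recursive_comp recursive_succ hF.
Qed.

Lemma computable_code (f : X -> Y) : computable f -> computable (fun x => code (f x)).
Proof. by move=> [F [hF FE]]; exists F. Qed.

Lemma computable_natrec (b : X -> Y) (s : X -> nat -> Y -> Y) (n : X -> nat) :
  computable b -> computable (fun p : X * (nat * Y) => s p.1 p.2.1 p.2.2) -> computable n ->
  computable (fun x => nat_rect (fun=> Y) (b x) (s x) (n x)).
Proof.
move=> [B [hB BE]] [S [hS SE]] [N [hN NE]]; eexists; split; first exact: recursive_natrec hB hS hN.
move=> x /=; rewrite NE [code (n x)]/code /code_nat; elim: (n x) => //= k ->.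
exact: (SE (x, (k, _))).
Qed.

(** Case analysis is a recursion whose step uses the index and forgets the previous value. *)
Lemma recursive_natcase G H N : recursive G -> recursive H -> recursive N ->
  recursive (fun n => if N n is k.+1 then H (cpair n k) else G n).
Proof.
move=> hG hH hN.
have hH' : recursive (fun m => H (cpair (ufst m) (ufst (usnd m)))).
  apply: (recursive_comp hH); apply: recursive_pair; first exact: recursive_ufst.
  exact: recursive_comp recursive_ufst recursive_usnd.
have [M hM] := recursive_natrec hG hH' hN; exists M => n.
suff -> : (if N n is k.+1 then H (cpair n k) else G n) =
  nat_rect (fun=> nat) (G n) (fun i z => H (cpair (ufst (cpair n (cpair i z)))
    (ufst (usnd (cpair n (cpair i z)))))) (N n) by exact: hM.
by case: (N n) => //= k; rewrite ufst_cpair usnd_cpair ufst_cpair.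
Qed.

Lemma computable_natcase (g : X -> Y) (h : X -> nat -> Y) (n : X -> nat) :
  computable g -> computable (fun p : X * nat => h p.1 p.2) -> computable n ->
  computable (fun x => if n x is k.+1 then h x k else g x).
Proof.
move=> [G [hG GE]] [H [hH HE]] [N [hN NE]]; eexists; split; first exact: recursive_natcase hG hH hN.
move=> x /=; rewrite NE [code (n x)]/code /code_nat; case: (n x) => // k.
exact: (HE (x, k)).
Qed.

Lemma computable_if (b : X -> bool) (f g : X -> Y) :
  computable b -> computable f -> computable g -> computable (fun x => if b x then f x else g x).
Proof.
move=> [B [hB BE]] [F [hF FE]] [G [hG GE]]; eexists; split.
  exact: recursive_natcase hG (recursive_comp hF recursive_ufst) hB.
by move=> x /=; rewrite BE; case: (b x) => //=; rewrite ufst_cpair.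
Qed.

Lemma computable_cons (f : X -> A) (g : X -> seq A) :
  computable f -> computable g -> computable (fun x => f x :: g x).
Proof.
move=> [F [hF FE]] [G [hG GE]]; exists (fun n => (cpair (F n) (G n)).+1).
split=> [|x]; last by rewrite FE GE.
exact: recursive_comp recursive_succ (recursive_pair hF hG).
Qed.

Lemma computable_seqcase (g : X -> Y) (h : X -> A -> seq A -> Y) (s : X -> seq A) :
  computable g -> computable (fun p : X * (A * seq A) => h p.1 p.2.1 p.2.2) -> computable s ->
  computable (fun x => if s x is a :: t then h x a t else g x).
Proof.
move=> [G [hG GE]] [H [hH HE]] [S [hS SE]]; eexists; split; first exact: recursive_natcase hG hH hS.
by move=> x /=; rewrite SE; case: (s x) => [|a t]; [exact: GE|exact: (HE (x, (a, t)))].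
Qed.

End Computable.

Lemma size_leq_code A {cA : Code A} (s : seq A) : size s <= code s.
Proof.
elim: s => //= a s IH; rewrite [X in _ <= X]/code /code_seq /= ltnS.
by apply: leq_trans IH _; rewrite /cpair leq_addl.
Qed.

Section ComputableSeq.
Context {X Y Z A B : Type} {cX : Code X} {cY : Code Y} {cZ : Code Z} {cA : Code A} {cB : Code B}.

(** The pair of remaining list and accumulator is iterated [code (s x)] times. By [size_leq_code]
    this is at least the length of the list, and the step idles once the list is exhausted. *)
Lemma computable_foldl (f : X -> Y -> A -> Y) (b : X -> Y) (s : X -> seq A) :
  computable (fun p : X * (Y * A) => f p.1 p.2.1 p.2.2) -> computable b -> computable s ->
  computable (fun x => foldl (f x) (b x) (s x)).
Proof.
move=> hf hb hs.
pose step x (st : seq A * Y) := if st.1 is a :: t then (t, f x st.2 a) else st.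
apply: (@computable_ext _ _ _ _ (fun x => (nat_rect (fun=> (seq A * Y)%type) (s x, b x)
   (fun _ => step x) (code (s x))).2)).
  move=> x; suff iterE n t c : size t <= n ->
      (nat_rect (fun=> (seq A * Y)%type) (t, c) (fun _ => step x) n).2 = foldl (f x) c t.
    by apply: iterE; exact: size_leq_code.
  have stepS m st : nat_rect (fun=> (seq A * Y)%type) st (fun _ => step x) m.+1 =
                    nat_rect (fun=> (seq A * Y)%type) (step x st) (fun _ => step x) m.
    by elim: m => //= m ->.
  elim: n t c => [|n IH] [|a t] c // tn; rewrite stepS /step /=; exact: IH.
apply: computable_snd; apply: computable_natrec.
- exact: computable_pair.
- apply: (computable_seqcase (g := fun p => p.2.2)
    (h := fun p a t => (t, f p.1 p.2.2.2 a)) (s := fun p => p.2.2.1)).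
  + exact/computable_snd/computable_snd/computable_id.
  + apply: computable_pair.
      exact/computable_snd/computable_snd/computable_id.
    apply: (computable_comp (f := fun p : X * (Y * A) => f p.1 p.2.1 p.2.2)
      (g := fun p : X * (nat * (seq A * Y)) * (A * seq A) => (p.1.1, (p.1.2.2.2, p.2.1)))) => //.
    apply: computable_pair; first exact/computable_fst/computable_fst/computable_id.
    apply: computable_pair; first
      exact/computable_snd/computable_snd/computable_snd/computable_fst/computable_id.
    exact/computable_fst/computable_snd/computable_id.
  exact/computable_fst/computable_snd/computable_snd/computable_id.
exact: computable_code.
Qed.

End ComputableSeq.

Notation computable2 f := (computable (fun p => f p.1 p.2)).

Lemma computable_app2 {X Y Z T} {cX : Code X} {cY : Code Y} {cZ : Code Z} {cT : Code T}
    (op : Y -> Z -> T) (f : X -> Y) (g : X -> Z) :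
  computable2 op -> computable f -> computable g -> computable (fun x => op (f x) (g x)).
Proof.
move=> hop hf hg; exact: (computable_comp (f := fun p => op p.1 p.2) (g := fun x => (f x, g x)))
  hop (computable_pair hf hg).
Qed.

Lemma computable_nat_of_bool {X} {cX : Code X} (b : X -> bool) :
  computable b -> computable (fun x => nat_of_bool (b x)).
Proof. exact: computable_code. Qed.

(* [comp] cannot match on a bare [if]. *)
Definition cond {T : Type} (b : bool) (x y : T) := if b then x else y.

Lemma computable_app3 {X Y Z T U} {cX : Code X} {cY : Code Y} {cZ : Code Z} {cT : Code T}
    {cU : Code U} (op : Y -> Z -> T -> U) (f : X -> Y) (g : X -> Z) (h : X -> T) :
  computable (fun p => op p.1 p.2.1 p.2.2) -> computable f -> computable g -> computable h ->
  computable (fun x => op (f x) (g x) (h x)).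
Proof.
move=> hop hf hg hh.
exact: (computable_comp (f := fun p => op p.1 p.2.1 p.2.2) (g := fun x => (f x, (g x, h x))))
  hop (computable_pair hf (computable_pair hg hh)).
Qed.

(* Syntax-directed proofs of computability *)
Create HintDb computable.

(** These two cases are filled in below, once list operations and equality tests are known to be
    computable. *)
Ltac comp_seq := fail.
Ltac comp_eq f g := fail.

Ltac comp :=
  cbv beta;
  lazymatch goal with
  | |- computable (fun _ => ?c) => apply: computable_const
  | |- computable (fun x => x) => apply: computable_id
  | |- computable (fun x => (@?f x, @?g x)) => apply: (@computable_pair _ _ _ _ _ _ f g); comp
  | |- computable (fun x => fst (@?f x)) => apply: (@computable_fst _ _ _ _ _ _ f); comp
  | |- computable (fun x => snd (@?f x)) => apply: (@computable_snd _ _ _ _ _ _ f); comp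
  | |- computable (fun x => S (@?f x)) => apply: (@computable_succ _ _ f); comp
  | |- computable (fun x => nat_of_bool (@?f x)) =>
      apply: (@computable_nat_of_bool _ _ f); comp
  | |- computable (fun x => (@?f x) :: (@?g x)) => apply: (@computable_cons _ _ _ _ f g); comp
  | |- computable (fun x => cond (@?b x) (@?f x) (@?g x)) =>
      apply: (@computable_if _ _ _ _ b f g); comp
  | |- computable (fun x => nat_rect _ (@?b x) (@?s x) (@?n x)) =>
      apply: (@computable_natrec _ _ _ _ b s n); comp
  | |- computable (fun x => foldl (@?f x) (@?b x) (@?s x)) =>
      apply: (@computable_foldl _ _ _ _ _ _ f b s); comp
  | |- computable (fun x => eq_op (@?f x) (@?g x)) => comp_eq f g; comp
  | |- _ => first [comp_seq; comp | comp_op | idtac]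
  end
with comp_op :=
  match goal with
  | |- computable (fun x => ?op (@?f x) (@?g x) (@?h x)) =>
      apply: (@computable_app3 _ _ _ _ _ _ _ _ _ _ op f g h);
      [solve [auto with computable]|comp|comp|comp]
  | |- computable (fun x => ?op (@?f x) (@?g x)) =>
      apply: (@computable_app2 _ _ _ _ _ _ _ _ op f g); [solve [auto with computable]|comp|comp]
  | |- computable (fun x => ?op (@?f x)) =>
      apply: (@computable_comp _ _ _ _ _ _ op f); [solve [auto with computable]|comp]
  end.

(** * Computability of arithmetic, Boolean and list operations *)

Lemma computable_pred : computable predn.
Proof.
apply: (computable_ext (f := fun n => if n is k.+1 then k else 0)); first by case.
apply: (computable_natcase (g := fun=> 0) (h := fun _ k => k) (n := fun n => n)); comp.
Qed.
#[export] Hint Resolve computable_pred : computable.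

Lemma computable_add : computable2 addn.
Proof.
apply: (computable_ext (f := fun p : nat * nat => nat_rect (fun=> nat) p.2 (fun _ z => z.+1) p.1)).
  by move=> [a b] /=; elim: a => //= a ->.
comp.
Qed.
#[export] Hint Resolve computable_add : computable.

Lemma computable_sub : computable2 subn.
Proof.
apply: (computable_ext (f := fun p : nat * nat => nat_rect (fun=> nat) p.1 (fun _ z => z.-1) p.2)).
  by move=> [a b] /=; elim: b => [|b] /=; lia.
comp.
Qed.
#[export] Hint Resolve computable_sub : computable.

Lemma computable_mul : computable2 muln.
Proof.
apply: (computable_ext (f := fun p : nat * nat => nat_rect (fun=> nat) 0 (fun _ z => p.2 + z) p.1)).
  by move=> [a b] /=; elim: a => //= a ->; rewrite mulSn.
comp.
Qed.
#[export] Hint Resolve computable_mul : computable.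

Lemma computable_exp : computable2 expn.
Proof.
apply: (computable_ext (f := fun p : nat * nat => nat_rect (fun=> nat) 1 (fun _ z => p.1 * z) p.2)).
  by move=> [a b] /=; elim: b => //= b ->; rewrite expnS.
comp.
Qed.
#[export] Hint Resolve computable_exp : computable.

Lemma computable_fact : computable factorial.
Proof.
apply: (computable_ext (f := fun n => nat_rect (fun=> nat) 1 (fun i z => i.+1 * z) n)).
  by elim=> //= n ->; rewrite factS.
comp.
Qed.
#[export] Hint Resolve computable_fact : computable.

Lemma computable_not : computable negb.
Proof. by apply: (computable_ext (f := fun b => cond b false true)); comp. Qed.
#[export] Hint Resolve computable_not : computable.

Lemma computable_and : computable2 andb.
Proof.
by apply: (computable_ext (f := fun p : bool * bool => cond p.1 p.2 false)); comp.
Qed.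
#[export] Hint Resolve computable_and : computable.

Lemma computable_or : computable2 orb.
Proof.
by apply: (computable_ext (f := fun p : bool * bool => cond p.1 true p.2)); comp.
Qed.
#[export] Hint Resolve computable_or : computable.

Lemma computable_eq_nat : computable (fun p : nat * nat => p.1 == p.2).
Proof.
apply: (computable_ext (f := fun p : nat * nat =>
  if (p.1 - p.2) + (p.2 - p.1) is k.+1 then false else true)).
  move=> [a b] /=; case: eqP => [->|ne]; first by rewrite subnn.
  by case E : (a - b + (b - a)) => //; lia.
apply: (computable_natcase (g := fun=> true) (h := fun _ _ => false)
  (n := fun p : nat * nat => (p.1 - p.2) + (p.2 - p.1))); comp.
Qed.

Lemma computable_eq_bool : computable (fun p : bool * bool => p.1 == p.2).
Proof.
by apply: (computable_ext (f := fun p : bool * bool => cond p.1 p.2 (~~ p.2)));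
  [case=> -[] []|comp].
Qed.

Lemma computable_eq_pair : computable (fun p : (nat * nat) * (nat * nat) => p.1 == p.2).
Proof.
apply: (computable_ext (f := fun p : (nat * nat) * (nat * nat) =>
  (p.1.1 == p.2.1) && (p.1.2 == p.2.2))); first by [].
apply: (@computable_app2 _ _ _ _ _ _ _ _ andb); first by auto with computable.
  apply: (computable_app2 computable_eq_nat (f := fun p => p.1.1) (g := fun p => p.2.1)); comp.
apply: (computable_app2 computable_eq_nat (f := fun p => p.1.2) (g := fun p => p.2.2)); comp.
Qed.

Ltac comp_eq f g ::=
  first [apply: (computable_app2 computable_eq_nat (f := f) (g := g))
        |apply: (computable_app2 computable_eq_bool (f := f) (g := g))
        |apply: (computable_app2 computable_eq_pair (f := f) (g := g))].

(** A counter that returns to 0 on reaching [d]. For [d = 0] it never returns, in accordance with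
    [modn0]. *)
Lemma computable_mod : computable2 modn.
Proof.
apply: (computable_ext (f := fun p : nat * nat => nat_rect (fun=> nat) 0
  (fun _ z => cond (z.+1 == p.2) 0 z.+1) p.1)); last by comp.
move=> [m d] /=; elim: m => [|m IH] /=; first by rewrite mod0n.
rewrite IH /cond {IH}.
case: d => [|d]; first by rewrite !modn0.
rewrite modnS; case: eqP => [e|ne].
  by rewrite /dvdn -addn1 -modnDml addn1 e modnn eqxx.
case: ifP => // /eqP h; case: ne.
have := ltn_pmod m (ltn0Sn d); rewrite leq_eqVlt => /orP[/eqP//|lt].
by move: h; rewrite -addn1 -modnDml addn1 modn_small.
Qed.
#[export] Hint Resolve computable_mod : computable.

Section Folds.
Context {X Y A : Type} {cX : Code X} {cY : Code Y} {cA : Code A}.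

Lemma computable_rev : computable (@rev A).
Proof.
apply: (computable_ext (f := foldl (fun s a => a :: s) [::])).
  move=> s; rewrite /rev -[RHS]cats0 -/(rev s).
  have gen t : foldl (fun s a => a :: s) t s = catrev s t by elim: s t => //= a s IH t.
  by rewrite gen /rev cats0.
have : computable (fun s : seq A => foldl (fun s a => a :: s) [::] s) by comp.
by [].
Qed.

Lemma computable_foldr (f : X -> A -> Y -> Y) (b : X -> Y) (s : X -> seq A) :
  computable (fun p : X * (A * Y) => f p.1 p.2.1 p.2.2) -> computable b -> computable s ->
  computable (fun x => foldr (f x) (b x) (s x)).
Proof.
move=> hf hb hs.
apply: (computable_ext (f := fun x => foldl (fun y a => f x a y) (b x) (rev (s x)))).
  by move=> x; rewrite foldl_rev.
apply: (@computable_foldl _ _ _ _ _ _ (fun x y a => f x a y)) => //.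
  apply: (computable_comp (f := fun p : X * (A * Y) => f p.1 p.2.1 p.2.2)
    (g := fun p : X * (Y * A) => (p.1, (p.2.2, p.2.1)))) => //; comp.
exact: (computable_comp computable_rev hs).
Qed.

End Folds.

Section SeqFunctions.
Context {X A B : Type} {cX : Code X} {cA : Code A} {cB : Code B}.

Lemma computable_has (P : X -> A -> bool) (s : X -> seq A) :
  computable (fun p : X * A => P p.1 p.2) -> computable s ->
  computable (fun x => has (P x) (s x)).
Proof.
move=> hP hs; apply: (computable_ext (f := fun x => foldr (fun a b => P x a || b) false (s x))).
  by move=> x; elim: (s x) => //= a t ->.
apply: (computable_foldr (f := fun x a b => P x a || b)) => //; comp.
Qed.

Lemma computable_map (f : X -> A -> B) (s : X -> seq A) :
  computable (fun p : X * A => f p.1 p.2) -> computable s ->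
  computable (fun x => map (f x) (s x)).
Proof.
move=> hf hs; apply: (computable_ext (f := fun x => foldr (fun a t => f x a :: t) [::] (s x))).
  by move=> x; elim: (s x) => //= a t ->.
apply: (computable_foldr (f := fun x a t => f x a :: t)) => //; comp.
Qed.

Lemma computable_filter (P : X -> A -> bool) (s : X -> seq A) :
  computable (fun p : X * A => P p.1 p.2) -> computable s ->
  computable (fun x => filter (P x) (s x)).
Proof.
move=> hP hs; apply: (computable_ext
  (f := fun x => foldr (fun a t => cond (P x a) (a :: t) t) [::] (s x))).
  by move=> x; elim: (s x) => //= a t ->.
apply: (computable_foldr (f := fun x a t => cond (P x a) (a :: t) t)) => //; comp.
Qed.

Lemma computable_size : computable (@size A).
Proof.
apply: (computable_ext (f := fun s => foldl (fun n _ => n.+1) 0 s)); last by comp.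
move=> s; have gen n : foldl (fun n (_ : A) => n.+1) n s = n + size s.
  by elim: s n => //= [|a s IH] n; rewrite ?addn0 // IH addSnnS.
exact: gen.
Qed.

End SeqFunctions.

#[export] Hint Resolve computable_rev computable_size : computable.

Ltac comp_seq ::=
  lazymatch goal with
  | |- computable (fun x => foldr (@?f x) (@?b x) (@?s x)) =>
      apply: (@computable_foldr _ _ _ _ _ _ f b s)
  | |- computable (fun x => has (@?f x) (@?s x)) => apply: (@computable_has _ _ _ _ f s)
  | |- computable (fun x => map (@?f x) (@?s x)) => apply: (@computable_map _ _ _ _ _ _ f s)
  | |- computable (fun x => filter (@?f x) (@?s x)) => apply: (@computable_filter _ _ _ _ f s)
  end.

Lemma computable_cat {A} {cA : Code A} : computable2 (@cat A).
Proof.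
apply: (computable_ext (f := fun p : seq A * seq A => foldr (fun a t => a :: t) p.2 p.1)).
  by move=> [s t] /=; elim: s => //= a s ->.
comp.
Qed.
#[export] Hint Resolve computable_cat : computable.

Lemma computable_iota0 : computable (iota 0).
Proof.
apply: (computable_ext (f := fun n => nat_rect (fun=> seq nat) [::] (fun i s => s ++ [:: i]) n)).
  by elim=> // n IH; rewrite -[in RHS]addn1 iotaD add0n -IH.
comp.
Qed.
#[export] Hint Resolve computable_iota0 : computable.

Lemma computable_phased : computable (fun p => phased p.1 p.2.1 p.2.2).
Proof.
apply: (computable_ext (f := fun p : nat * (nat * seq nat) =>
  (foldl (fun (st : nat * seq (nat * nat)) a => (st.1.+1, st.2 ++ [:: (a, st.1 %% p.1)]))
     (p.2.1, [::]) p.2.2).2)).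
  move=> [d [t w]] /=; rewrite -[RHS]cat0s; move: {2 3}[::] => s.
  by elim: w t s => [|a w IH] t s /=; [rewrite cats0|rewrite IH -catA].
comp.
Qed.
#[export] Hint Resolve computable_phased : computable.

(** One step of greedy matching, which returns the part of the pattern still to be found. It turns
    the subword test into a fold over the longer word. *)
Definition match_head (s : seq (nat * nat)) (y : nat * nat) :=
  if s is x :: s' then cond (x == y) s' s else [::].

Lemma computable_match_head : computable2 match_head.
Proof.
apply: (computable_seqcase (g := fun=> [::])
  (h := fun (p : seq (nat * nat) * (nat * nat)) x s' => cond (x == p.2) s' p.1)
  (s := fun p : seq (nat * nat) * (nat * nat) => p.1)); comp.
Qed.
#[export] Hint Resolve computable_match_head : computable.

Lemma computable_subseq : computable2 (@subseq (nat * nat)%type).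
Proof.
apply: (computable_ext (f := fun p : seq (nat * nat) * seq (nat * nat) =>
  size (foldl match_head p.1 p.2) == 0)).
  move=> [s t] /=; elim: t s => [|y t IH] s /=; first by case: s.
  case: s => [|x s] /=; first by rewrite IH sub0seq.
  by rewrite IH.
comp.
Qed.
#[export] Hint Resolve computable_subseq : computable.

Lemma computable_allpairs {A B C : Type} {cA : Code A} {cB : Code B} {cC : Code C}
    (f : A -> B -> C) : computable2 f ->
  computable (fun p : seq A * seq B => allpairs f p.1 p.2).
Proof.
move=> hf; apply: (computable_ext (f := fun p : seq A * seq B =>
  foldr (fun a r => map (f a) p.2 ++ r) [::] p.1)).
  by move=> [s t] /=; elim: s => //= a s ->.
comp.
Qed.

Lemma computable_allpairs_pair : computable2 (@allpairs nat nat (nat * nat) pair).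
Proof. apply: computable_allpairs; comp. Qed.
#[export] Hint Resolve computable_allpairs_pair : computable.

Lemma computable_words_upto {A} {cA : Code A} : computable2 (@words_upto A).
Proof.
apply: (computable_ext (f := fun p : seq A * nat =>
  nat_rect (fun=> seq (seq A)) [:: [::]] (fun _ ws => [::] :: allpairs cons p.1 ws) p.2)).
  by move=> [G n] /=; elim: n => //= n ->.
have hcons : computable2 (@allpairs A (seq A) (seq A) cons) by apply: computable_allpairs; comp.
comp.
Qed.
#[export] Hint Resolve computable_words_upto : computable.

(** * Computability of the bounds and of the separability test *)

Lemma computable_star_weight : computable2 star_weight.
Proof.
apply: (computable_ext (f := fun p : nat * nat =>
  nat_rect (fun=> nat) 1 (fun i z => (z + p.1 * i.+1 * z.+1).+1) p.2)).
  by move=> [N b] /=; elim: b => //= b ->.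
comp.
Qed.
#[export] Hint Resolve computable_star_weight : computable.

Lemma computable_base_modulus : computable base_modulus.
Proof. rewrite /base_modulus; comp. Qed.
#[export] Hint Resolve computable_base_modulus : computable.

Lemma computable_base_rank : computable2 base_rank.
Proof. rewrite /base_rank; comp. Qed.
#[export] Hint Resolve computable_base_rank : computable.

Lemma computable_phased_letters : computable2 phased_letters.
Proof. rewrite /phased_letters; comp. Qed.
#[export] Hint Resolve computable_phased_letters : computable.

Lemma computable_short_bound :
  computable (fun p => short_bound p.1 p.2.1 p.2.2.1 p.2.2.2).
Proof. rewrite /short_bound; comp. Qed.

Lemma computable_type_equivb : computable (fun p : (nat * (nat * nat)) * (seq nat * seq nat) =>
  type_equivb p.1.1 p.1.2.1 p.1.2.2 p.2.1 p.2.2).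
Proof.
apply: (computable_ext (f := fun p : (nat * (nat * nat)) * (seq nat * seq nat) =>
  (size p.2.1 %% p.1.2.1 == size p.2.2 %% p.1.2.1) &&
  ~~ has (fun x => ~~ (subseq x (phased p.1.2.1 1 p.2.1) == subseq x (phased p.1.2.1 1 p.2.2)))
    (words_upto (phased_letters p.1.1 p.1.2.1) p.1.2.2))).
  by move=> p; rewrite -all_predC /type_equivb; congr (_ && _); apply: eq_all => x /=; rewrite negbK.
comp.
Qed.

(** The nesting follows [enc_nfa], so that the code of this tuple is the prescribed code of the
    automaton. *)
Definition nfa_data := (seq nat * (seq nat * seq (nat * nat * nat)))%type.

Definition nfa_of (D : nfa_data) := NFA D.1 D.2.1 D.2.2.

Lemma computable_nfa_accepts :
  computable (fun p : nfa_data * seq nat => nfa_accepts (nfa_of p.1) p.2).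
Proof.
apply: (computable_ext (f := fun p : nfa_data * seq nat =>
  has (fun q => has (fun r => r == q) p.1.2.1)
    (foldl (fun S a => map (fun t => t.2)
       (filter (fun t => has (fun r => r == t.1.1) S && (t.1.2 == a)) p.1.2.2)) p.1.1 p.2))).
  move=> [[I [F T]] w]; rewrite /nfa_accepts /=.
  have -> : foldl (nfa_step (nfa_of (I, (F, T)))) I w =
      foldl (fun S a => map (fun t => t.2)
       (filter (fun t => has (fun r => r == t.1.1) S && (t.1.2 == a)) T)) I w.
    elim: w I => //= a w IH I; rewrite -IH; congr foldl; rewrite /nfa_step /=.
    by congr map; apply: eq_filter => t; rewrite has_pred1.
  by apply: eq_has => q; rewrite has_pred1.
comp.
Qed.
#[export] Hint Resolve computable_nfa_accepts : computable.

Lemma computable_separability_test :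
  computable (fun p : nat * (nfa_data * nfa_data) =>
    separability_test p.1 (nfa_of p.2.1) (nfa_of p.2.2)).
Proof.
rewrite /separability_test; cbv zeta.
pose m (p : nat * (nfa_data * nfa_data)) := size p.2.1.2.2 + size p.2.2.2.2.
pose d p := base_modulus (m p).
pose n p := base_rank p.1 (m p).
pose ws p := words_upto (iota 0 p.1) (short_bound p.1 (d p) (n p) (m p)).
have hm : computable m by rewrite /m; comp.
have hd : computable d by rewrite /d; comp.
have hn : computable n by rewrite /n; comp.
have hb : computable (fun p => short_bound p.1 (d p) (n p) (m p)).
  apply: (computable_comp computable_short_bound (g := fun p => (p.1, (d p, (n p, m p))))).
  comp.
have hws : computable ws.
  rewrite /ws; apply: (@computable_app2 _ _ _ _ _ _ _ _ (@words_upto nat) (fun p => iota 0 p.1)).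
  - by auto with computable.
  - by comp.
  - exact: hb.
apply: (computable_ext (f := fun p => ~~ has (fun w => nfa_accepts (nfa_of p.2.1) w &&
   has (fun w' => nfa_accepts (nfa_of p.2.2) w' && type_equivb p.1 (d p) (n p) w w') (ws p)) (ws p))).
  by [].
have h1 : computable (fun q : (nat * (nfa_data * nfa_data)) * seq nat =>
    nfa_accepts (nfa_of q.1.2.1) q.2).
  apply: (computable_comp computable_nfa_accepts (g := fun q => (q.1.2.1, q.2))); comp.
have h2 : computable (fun q : (nat * (nfa_data * nfa_data)) * (seq nat * seq nat) =>
    nfa_accepts (nfa_of q.1.2.2) q.2.2 && type_equivb q.1.1 (d q.1) (n q.1) q.2.1 q.2.2).
  apply: (@computable_app2 _ _ _ _ _ _ _ _ andb); first by auto with computable.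
    apply: (computable_comp computable_nfa_accepts (g := fun q => (q.1.2.2, q.2.2))); comp.
  apply: (computable_comp computable_type_equivb
    (g := fun q => ((q.1.1, (d q.1, n q.1)), (q.2.1, q.2.2)))); comp.
apply: (computable_comp computable_not).
apply: (computable_has (s := ws) (P := fun p w => nfa_accepts (nfa_of p.2.1) w &&
   has (fun w' => nfa_accepts (nfa_of p.2.2) w' && type_equivb p.1 (d p) (n p) w w') (ws p))) => //.
apply: (@computable_app2 _ _ _ _ _ _ _ _ andb); [by auto with computable|exact: h1|].
apply: (computable_has (s := fun q : (nat * (nfa_data * nfa_data)) * seq nat => ws q.1)
  (P := fun q w' => nfa_accepts (nfa_of q.1.2.2) w' && type_equivb q.1.1 (d q.1) (n q.1) q.2 w')).
  apply: (computable_comp h2 (g := fun r => (r.1.1, (r.1.2, r.2)))); comp.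
exact: (computable_comp hws (computable_fst computable_id)).
Qed.

Definition data_of (A : nfa) : nfa_data := (n_init A, (n_final A, n_trans A)).

Lemma code_data_of A : code (data_of A) = enc_nfa A.
Proof.
case: A => I F T; rewrite /enc_nfa /data_of /= /code /code_prod /= /code /code_seq.
by rewrite !map_id.
Qed.

(* Decidability: a single partial recursive function which, on the code of
   any instance (k, A, B), halts with output 1 if L(A) and L(B) are
   BΣ1[<,MOD]-separable and with output 0 otherwise. *)
Theorem mainTheorem5 :
  exists M : prf, forall (k : nat) (A B : nfa),
    (BSigma1MOD_separable k (nfa_lang k A) (nfa_lang k B) ->
       eval M [:: enc_instance k A B] 1) /\
    (~ BSigma1MOD_separable k (nfa_lang k A) (nfa_lang k B) ->
       eval M [:: enc_instance k A B] 0).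
Proof.
have [F [[M hM] FE]] := computable_separability_test; exists M => k A B.
have := FE (k, (data_of A, data_of B)); have := hM (enc_instance k A B).
have -> : code (k, (data_of A, data_of B)) = enc_instance k A B.
  by rewrite /enc_instance -!code_data_of.
have -> : nfa_of (data_of A) = A by case: (A).
have -> : nfa_of (data_of B) = B by case: (B).
move=> /[swap] ->; rewrite [code _]/code /code_bool /=.
by have [sep|nsep] := separability_testP k A B; split.
Qed.
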